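(* For any irrational number $\alpha$, there is a minimal $C^1$-diffeomorphism of the circle $S^1=\mathbb{R}/\mathbb{Z}$ with rotation number $\alpha$ which admits a measurable fundamental domain with respect to the Lebesgue measure.
   Context: Given a standard probability space $(X,\mu)$ and a transformation $T$ of $X$ leaving $\mu$ quasi-invariant (i.e. the push-forward $T_*\mu$ is equivalent to $\mu$), a Borel subset $C$ of $X$ is called a measurable fundamental domain of $T$ (with respect to $\mu$) if the sets $T^nC$ ($n\in\mathbb{Z}$) are mutually disjoint and the union $\bigcup_{n\in\mathbb{Z}}T^nC$ is conull. A $C^1$-diffeomorphism of the circle always leaves the Lebesgue measure quasi-invariant. Minimal means that every orbit is dense. The rotation number is understood as an element of $\mathbb{R}/\mathbb{Z}$. *)

(* Defs.v *)
From HB Require Import structures.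
From mathcomp Require Import all_boot all_order all_algebra.
From mathcomp Require Import archimedean generic_quotient.
From mathcomp Require Import all_classical all_reals all_analysis.

Set Implicit Arguments.
Unset Strict Implicit.
Unset Printing Implicit Defensive.

Import Order.TTheory GRing.Theory Num.Theory.
Import numFieldNormedType.Exports.

Local Open Scope classical_set_scope.
Local Open Scope ring_scope.
Local Open Scope quotient_scope.

Section Circle.
Variable R : realType.

Definition circle_eq : rel R := fun x y => (x - y) \is a Num.int.

Lemma circle_eq_refl : reflexive circle_eq.
Proof. by move=> x; rewrite /circle_eq subrr rpred0. Qed.

Lemma circle_eq_sym : symmetric circle_eq.
Proof. by move=> x y; rewrite /circle_eq -opprB rpredN. Qed.

Lemma circle_eq_trans : transitive circle_eq.
Proof.
move=> y x z xy yz; rewrite /circle_eq.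
have -> : x - z = (x - y) + (y - z) by rewrite addrA subrK.
exact: rpredD.
Qed.

Canonical circle_equiv :=
  EquivRel circle_eq circle_eq_refl circle_eq_sym circle_eq_trans.

Definition circle : Type := {eq_quot circle_equiv}.

HB.instance Definition _ := Quotient.copy circle {eq_quot circle_equiv}.
HB.instance Definition _ :=
  PointedTopological.copy circle (quotient_topology {eq_quot circle_equiv}).

Definition circle_proj (x : R) : circle := \pi_circle x.

Lemma circle_projP (x y : R) :
  circle_proj x = circle_proj y <-> (x - y) \is a Num.int.
Proof. by split=> [/eqmodP|h]; last apply/eqmodP. Qed.

Lemma circle_proj_continuous : continuous circle_proj.
Proof. exact: (@pi_continuous R {eq_quot circle_equiv}). Qed.

Lemma circle_proj_surj (p : circle) : exists x, circle_proj x = p.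
Proof. by exists (repr p); exact: reprK. Qed.

Definition circle_open : set (set circle) := open.

HB.instance Definition _ :=
  Measurable.copy circle (g_sigma_algebraType circle_open).

Lemma measurable_circle_proj :
  measurable_fun [set: measurableTypeR R] circle_proj.
Proof.
apply: (@measurability _ _ _ _ _ _ circle_open) => //.
move=> _ [U oU <-]; rewrite setTI; apply: measurable_realfun.open_measurable.
by move/continuousP : circle_proj_continuous; apply.
Qed.

Definition circle_lebesgue : set circle -> \bar R :=
  pushforward
    (mrestr (@lebesgue_measure R) (measurable_itv `[(0 : R), 1[)) circle_proj.

Let circle_measure : {measure set circle -> \bar R} :=
  measure_function_pushforward__canonical__measure_function_Measure
    (mrestr (@lebesgue_measure R) (measurable_itv `[(0 : R), 1[))
    measurable_circle_proj.

HB.instance Definition _ := isMeasure.Build _ _ _ circle_lebesgue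
  (measure0 circle_measure) (measure_ge0 circle_measure)
  (@measure_semi_sigma_additive _ _ _ circle_measure).

Lemma circle_lebesgue_setT : circle_lebesgue setT = 1%E.
Proof.
rewrite /circle_lebesgue /pushforward /mrestr preimage_setT setTI.
by rewrite lebesgue_measure_itv /= lte_fin ltr01 oppr0 adde0.
Qed.

HB.instance Definition _ :=
  Measure_isProbability.Build _ _ _ circle_lebesgue circle_lebesgue_setT.

End Circle.

Arguments circle_lebesgue R _ : clear implicits.

(* The image T^n(C) for n in Z; for n < 0 it is the preimage of C under
   T^(-n), so that no inverse of the bijection T has to be named. *)
Definition ziter_image (X : Type) (T : X -> X) (n : int) (C : set X) : set X :=
  match n with
  | Posz k => iter k T @` C
  | Negz k => iter k.+1 T @^-1` C
  end.

(* Meaningful for an invertible T leaving mu quasi-invariant. *)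
Definition measurable_fundamental_domain d (X : measurableType d)
    (R : realType) (mu : probability X R) (T : X -> X) (C : set X) : Prop :=
  [/\ measurable C,
      trivIset [set: int] (fun n => ziter_image T n C) &
      mu.-negligible (~` \bigcup_(n in [set: int]) ziter_image T n C)].

Definition orbit_of (X : Type) (T : X -> X) (x : X) : set X :=
  \bigcup_(n in [set: int]) ziter_image T n [set x].

Definition minimal (X : topologicalType) (T : X -> X) : Prop :=
  forall x, dense (orbit_of T x).

Section CircleDynamics.
Variable R : realType.
Implicit Types (f : circle R -> circle R) (F : R -> R).

Definition is_lift f F : Prop :=
  forall x, circle_proj (F x) = f (circle_proj x).

Definition real_C1 F : Prop :=
  (forall x, derivable F x 1) /\ continuous (derive1 F).

(* The projection R -> R/Z is a local diffeomorphism and R is simply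
   connected, so a map of the circle is C^1 iff it has a C^1 lift to R. *)
Definition circle_C1 f : Prop := exists2 F, is_lift f F & real_C1 F.

Definition circle_C1_diffeo f : Prop :=
  exists g, [/\ cancel f g, cancel g f, circle_C1 f & circle_C1 g].

(* The third and fourth conditions say that the homeomorphism f preserves
   orientation, as is required for its rotation number to be defined. *)
Definition orientation_preserving_lift f F : Prop :=
  [/\ is_lift f F, continuous F, {homo F : x y / x < y} &
      forall x, F (x + 1) = F x + 1].

(* rho is the class mod Z of the translation number
   lim_n (F^n(x) - x) / n of an orientation preserving lift F of f. *)
Definition has_rotation_number f (rho : circle R) : Prop :=
  exists F r, [/\ orientation_preserving_lift f F,
    forall x, (iter n F x - x) / n%:R @[n --> \oo] --> r &
    circle_proj r = rho].

End CircleDynamics.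

(* Main.v *)
Require Import Defs.
From HB Require Import structures.
From mathcomp Require Import all_boot all_order all_algebra.
From mathcomp Require Import archimedean generic_quotient.
From mathcomp Require Import all_classical all_reals all_analysis.
From mathcomp Require Import measurable_realfun.
From mathcomp Require Import zify ring lra.

Set Implicit Arguments.
Unset Strict Implicit.
Unset Printing Implicit Defensive.

Import Order.TTheory GRing.Theory Num.Theory.
Import numFieldNormedType.Exports.

Local Open Scope classical_set_scope.
Local Open Scope ring_scope.

(** The diffeomorphism is a rotation in disguise: f = H o (x |-> x + alpha) o G,
    where G is the inverse of H and H is the distribution function of a
    probability measure m on R / Z.  If m has full support and no atoms then H is
    a homeomorphism, so f is minimal with rotation number alpha; H carries m to
    the Lebesgue measure.  Two more properties of m are wanted.

    - m is conformal: the rotation multiplies it by a positive continuous function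
      phi.  Then f is C^1, with derivative phi o G.
    - m is carried by the disjoint union of the rotates C + n alpha of a Cantor
      set C.  Then H (C) is a fundamental domain of f.

    So m is sought as the sum over n in Z of the translates by n alpha of an
    atomless measure on C with a density; the density at y + (n + 1) alpha must
    be phi (y + n alpha) times that at y + n alpha.  The difficulty is that the
    total mass is finite, so that the density tends to 0 along each orbit in both
    directions of time, while phi is continuous on the circle.

    The Cantor set consists of the sums of b_k / q_(k+1), where the b_k are the
    binary digits of a number and the integers q_k grow so fast that C is
    uniformly well approximated by rationals.  As alpha is irrational, the rotates of C by
    |n| <= N steps are then at a positive distance from each other
    (sparse_denominators, exists_orbit_parametrization).

    The density is exp (- sum_k g_k), where g_k (x) is the least cost of reaching
    x from C if a step of the rotation costs 2 ^- k and a displacement by d costs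
    lam_k * d (gauge).  Each g_k is continuous and changes by at most 2 ^- k under
    the rotation, so that ln phi = sum_k (g_k (x) - g_k (x + alpha)) converges
    uniformly, although sum_k g_k is infinite at some points.  On y + n alpha
    the cost g_k is 2 ^- k * |n| as long as |n| is not too large with respect to
    lam_k, and this makes the density at most 1 / n ^ 2 for large |n|
    (gauge_orbit_ge, exists_weight).

    All the translates of C are parametrised at once by the real line: kappa t is
    the point of C with parameter t - floor t, moved by floor t * alpha.  Thus m
    is the law of kappa t modulo 1 for t distributed with an integrable density W
    on R, and the cocycle relation reads W (t + 1) = phi (kappa t) * W t.
    Conformality is then the translation invariance of the Lebesgue measure
    (orbit_cdf_conformal, conj_translation_derive), and the union of the images of
    H (C) is conull because H (kappa t) modulo 1 is uniformly distributed
    (orbit_cdf_law). *)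

(** * Rational approximation *)

Section Denominators.
Variables (R : realType) (alpha : R).
Hypothesis alpha_irr : irrational alpha.

Lemma irrational_mulz (m l : int) : m != 0 -> m%:~R * alpha != l%:~R.
Proof.
move=> m0; apply/eqP => h; apply: alpha_irr.
exists (l%:~R / m%:~R) => //; rewrite fmorph_div/= !ratr_int -h mulrC mulKf//.
by rewrite intr_eq0.
Qed.

Lemma dist_int_gt0 (x : R) : x \isn't a Num.int ->
  exists2 e : R, 0 < e & forall l : int, e <= `|x - l%:~R|.
Proof.
move=> xint; have /andP[fx xf] := floor_itv x.
have fx' : (Num.floor x)%:~R < x.
  rewrite lt_neqAle fx andbT; apply: contra xint => /eqP <-.
  exact: intr_int.
(* the distance to the two neighbouring integers *)
exists (Num.min (x - (Num.floor x)%:~R) ((Num.floor x + 1)%:~R - x)).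
  by rewrite lt_min !subr_gt0 fx'.
move=> l; have [lx|xl] := lerP l (Num.floor x).
  rewrite ge_min; apply/orP; left.
  rewrite ger0_norm; last by rewrite subr_ge0 (le_trans _ fx)// ler_int.
  by rewrite lerB// ler_int.
rewrite ge_min; apply/orP; right.
have h : (Num.floor x + 1)%:~R <= l%:~R :> R by rewrite ler_int; lia.
rewrite distrC ger0_norm; first by rewrite lerB.
by rewrite subr_ge0 (le_trans (ltW xf)).
Qed.

Lemma sep_scale (q k : nat) : (0 < q)%N ->
  exists2 r : nat, (4 <= r)%N & forall j l : int, j != 0 -> (`|j| <= k)%N ->
    4 <= r%:R * `|q%:R * (j%:~R * alpha) - l%:~R|.
Proof.
move=> q0; elim: k => [|k [r r4 IH]].
  by exists 4%N => // j l j0; rewrite leqn0 absz_eq0 (negbTE j0).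
have /dist_int_gt0[e e0 he] : q%:R * (k.+1%:R * alpha) \isn't a Num.int.
  apply/negP => /intrP[l]; rewrite mulrA -natrM => /eqP.
  apply/negP; apply: (@irrational_mulz (Posz (q * k.+1)) l).
  by rewrite eqz_nat muln_eq0 negb_or -lt0n q0.
pose r' := (Num.bound (4 / e)).
have hr' : 4 <= r'%:R * e.
  by rewrite -ler_pdivrMr//; apply/ltW/archi_boundP/divr_ge0 => //; exact: ltW.
exists (maxn r r') => [|j l j0]; first by rewrite leq_max r4.
rewrite leq_eqVlt => /orP[/eqP jk|jk]; last first.
  apply: le_trans (IH j l j0 _) _; first by rewrite -ltnS.
  by rewrite ler_wpM2r// ler_nat leq_maxl.
have hmax : 4 <= (maxn r r')%:R * e.
  by rewrite (le_trans hr')// ler_wpM2r ?(ltW e0)// ler_nat leq_maxr.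
apply: le_trans hmax _; apply: ler_wpM2l => //.
have [jE|jE] : j = Posz k.+1 \/ j = - Posz k.+1 by lia.
  by rewrite jE; apply: he.
rewrite jE rmorphN/= mulNr mulrN -opprD normrN.
by have := he (- l); rewrite rmorphN opprK.
Qed.

(** The numbers 1 / q k will be the place values of the points of the Cantor
    set.  The point of the last condition is that its points, which are within
    2 / q k.+1 of fractions of denominator q k, cannot differ by j * alpha
    modulo 1 for 0 < |j| <= k. *)
Lemma sparse_denominators : exists q : nat -> nat,
  [/\ q 0%N = 1%N, forall k, (0 < q k)%N, forall k, (q k %| q k.+1)%N,
      forall k, (4 * q k <= q k.+1)%N &
      forall k (j l : int), j != 0 -> (`|j| <= k)%N ->
        4 * (q k)%:R <= (q k.+1)%:R * `|(q k)%:R * (j%:~R * alpha) - l%:~R|].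
Proof.
have /choice[r hr] : forall qk : nat * nat, exists r : nat, (0 < qk.1)%N ->
    (4 <= r)%N /\ forall j l : int, j != 0 -> (`|j| <= qk.2)%N ->
    4 <= r%:R * `|qk.1%:R * (j%:~R * alpha) - l%:~R|.
  move=> [q k]; have [q0|] := boolP (0 < q)%N; last by exists 0%N.
  by have [r ? ?] := sep_scale k q0; exists r.
pose fix q (k : nat) : nat :=
  if k is k'.+1 then (q k' * r (q k', k'))%N else 1%N.
have q0 k : (0 < q k)%N.
  elim: k => //= k IH; rewrite muln_gt0 IH/=.
  by have [/(leq_trans _)->] := hr (q k, k) IH.
exists q; split => // k.
- by rewrite /= dvdn_mulr.
- by rewrite /= mulnC leq_mul2l; have [-> _] := hr (q k, k) (q0 k); rewrite orbT.
- move=> j l j0 jk /=; rewrite natrM [leLHS]mulrC -mulrA ler_wpM2l//.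
  by have [_] := hr (q k, k) (q0 k); apply.
Qed.

End Denominators.

(** * The Cantor set *)

Section Digits.
Variable R : realType.

(** The k-th digit of the binary expansion of the fractional part of t. *)
Definition digit (k : nat) (t : R) : int :=
  Num.floor (2 ^+ k.+1 * t) - 2 * Num.floor (2 ^+ k * t).

Lemma digit_ge0 k t : 0 <= digit k t.
Proof.
rewrite /digit subr_ge0 floor_ge_int exprS -mulrA.
have := floor_le (2 ^+ k * t); move: (2 ^+ k * t) (Num.floor _) => x n.
by rewrite rmorphM/=; lra.
Qed.

Lemma digit_le1 k t : digit k t <= 1.
Proof.
suff : digit k t < 2 by lia.
rewrite /digit ltrBlDr floor_lt_int exprS -mulrA.
have := floorD1_gt (2 ^+ k * t); move: (2 ^+ k * t) (Num.floor _) => x n.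
by rewrite !rmorphD !rmorphM/=; lra.
Qed.

Lemma digitD1 k t : digit k (t + 1) = digit k t.
Proof.
rewrite /digit !mulrDr !mulr1.
have h j : (2 : R) ^+ j = (2 ^+ j)%:~R by rewrite rmorphXn.
rewrite !h !floorDrz ?intr_int// !intrKfloor [X in _ + X - _]exprS; ring.
Qed.

Lemma digit_small k t : 0 <= t -> 2 ^+ k.+1 * t < 1 -> digit k t = 0.
Proof.
move=> t0 t1.
have f0 j : (j <= k.+1)%N -> Num.floor (2 ^+ j * t) = 0.
  move=> jk; apply: floor_def; rewrite mulr_ge0 ?exprn_ge0//=.
  apply: le_lt_trans t1; rewrite ler_wpM2r//; apply: ler_weXn2l => //; lra.
by rewrite /digit !f0.
Qed.

(** The order of two reals with the same integer part is read off the first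
    binary digit at which they differ; such a digit exists because
    2 ^ k * (t - s) > 1 for some k. *)
Lemma digit_first_diff (s t : R) : Num.floor s = Num.floor t -> s < t ->
  exists2 k, (forall j, (j < k)%N -> digit j s = digit j t) &
             digit k s < digit k t.
Proof.
move=> st0 st.
have [k] : exists k, Num.floor (2 ^+ k * s) != Num.floor (2 ^+ k * t).
  have [n] : exists n, (t - s)^-1 < 2 ^+ n.
    exists (Num.bound (t - s)^-1).
    have h : (0 : R) <= (t - s)^-1 by rewrite invr_ge0 subr_ge0 ltW.
    rewrite (lt_le_trans (archi_boundP h))// -natrX ler_nat ltnW//.
    exact: ltn_expl.
  move=> hn; exists n; apply/eqP => E.
  have := floor_le (2 ^+ n * s); have := floorD1_gt (2 ^+ n * t); rewrite -E.
  have : 1 < 2 ^+ n * (t - s) by rewrite -ltr_pdivrMr ?subr_gt0// mul1r.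
  by rewrite rmorphD/= mulrBr; lra.
move=> hk; have /ex_minnP[m] : exists k,
    Num.floor (2 ^+ k * s) != Num.floor (2 ^+ k * t) by exists k.
case: m => [|m] hm mmin; first by rewrite !expr0 !mul1r st0 eqxx in hm.
have E j : (j <= m)%N -> Num.floor (2 ^+ j * s) = Num.floor (2 ^+ j * t).
  move=> jm; apply/eqP; apply: contraT => /mmin; lia.
exists m => [j jm|]; first by rewrite /digit !E// ltnW.
rewrite /digit (E m)// ltrD2r lt_neqAle hm/=.
by apply: le_floor; rewrite ler_pM2l ?exprn_gt0// ltW.
Qed.

Lemma measurable_digit k : measurable_fun setT (fun t : R => (digit k t)%:~R : R).
Proof.
have mf j : measurable_fun setT (fun t : R => (Num.floor (2 ^+ j * t))%:~R : R).
  apply: nondecreasing_measurable => // s t st.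
  by rewrite ler_int le_floor// ler_pM2l ?exprn_gt0.
rewrite [X in measurable_fun _ X](_ : _ = fun t =>
  (Num.floor (2 ^+ k.+1 * t))%:~R - 2 * (Num.floor (2 ^+ k * t))%:~R); last first.
  by apply/funext => t; rewrite /digit rmorphB rmorphM.
by apply: measurable_funB => //; apply: measurable_funM.
Qed.

End Digits.

(** All that is used of the Cantor set.  The values of kappa on [[0, 1[ lie in
    it, and adding 1 to t applies the translation by alpha, so that one real
    parameter t records both a point of the set and the number floor t of
    steps made along its orbit.  The third condition makes the law of kappa
    modulo 1 atomless, the fourth one keeps the rotates of the set apart, and
    the last one shows that every interval has positive measure. *)
Definition orbit_parametrization (R : realType) (alpha : R) (kappa : R -> R) :=
  [/\ measurable_fun setT kappa,
      forall t, kappa (t + 1) = kappa t + alpha,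
      forall s t, Num.floor s = Num.floor t ->
        kappa s - kappa t \is a Num.int -> s = t,
      forall N, exists2 e : R, 0 < e & forall s t (l : int),
        Num.floor s != Num.floor t -> (`|(Num.floor s - Num.floor t)%R| <= N)%N ->
        e <= `|kappa s - kappa t - l%:~R| &
      forall e : R, 0 < e -> exists2 r : R, 0 < r &
        forall t, 0 <= t < r -> 0 <= kappa t < e].

Lemma shift_int (R : realType) (F : R -> R) (c : R) :
  (forall x, F (x + 1) = F x + c) ->
  forall x (n : int), F (x + n%:~R) = F x + n%:~R * c.
Proof.
move=> FD x n; have FDn y (m : nat) : F (y + m%:R) = F y + m%:R * c.
  elim: m => [|m IH]; first by rewrite addr0 mul0r addr0.
  by rewrite -natr1 addrA FD IH mulrDl mul1r addrA.
case: n => n; first exact: FDn.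
have := FDn (x + (Negz n)%:~R) n.+1.
by rewrite NegzE rmorphN/= subrK => ->; rewrite mulNr addrK.
Qed.

Section Kappa.
Variables (R : realType) (alpha : R) (q : nat -> nat).
Hypotheses (q_0 : q 0%N = 1%N) (q_gt0 : forall k, (0 < q k)%N).
Hypothesis q_dvd : forall k, (q k %| q k.+1)%N.
Hypothesis q_growth : forall k, (4 * q k <= q k.+1)%N.
Hypothesis q_sep : forall k (j l : int), j != 0 -> (`|j| <= k)%N ->
  4 * (q k)%:R <= (q k.+1)%:R * `|(q k)%:R * (j%:~R * alpha) - l%:~R|.

Let d k : R := (q k)%:R^-1.

Let d_gt0 k : 0 < d k. Proof. by rewrite invr_gt0 ltr0n. Qed.

Let d_growth k : 4 * d k.+1 <= d k.
Proof.
have q0 j : (0 : R) < (q j)%:R by rewrite ltr0n.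
rewrite /d ler_pdivrMr// mulrC ler_pdivlMr//.
by have := q_growth k; rewrite -(ler_nat R) natrM.
Qed.

Let iota_part m (t : R) : R := \sum_(j < m) (digit j t)%:~R * d j.+1.

Let iota_partS m t :
  iota_part m.+1 t = iota_part m t + (digit m t)%:~R * d m.+1.
Proof. by rewrite /iota_part big_ord_recr. Qed.

Let digit_ge0R k (t : R) : 0 <= (digit k t)%:~R :> R.
Proof. by rewrite ler0z digit_ge0. Qed.

Let digit_le1R k (t : R) : (digit k t)%:~R <= 1 :> R.
Proof. by rewrite (ler_int _ _ 1) digit_le1. Qed.

Let iota_part_nd t : nondecreasing_seq (iota_part ^~ t).
Proof.
by apply/nondecreasing_seqP => m; rewrite iota_partS lerDl mulr_ge0// ltW.
Qed.

(* The tail of the expansion after the m-th digit is at most a geometric sum. *)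
Let iota_part_ub t m n : (m <= n)%N ->
  iota_part n t <= iota_part m t + 2 * d m.+1.
Proof.
have ni : nonincreasing_seq (fun k => iota_part k t + 2 * d k.+1).
  apply/nonincreasing_seqP => k; rewrite iota_partS.
  have := d_growth k.+1; have := digit_le1R k t.
  by have := d_gt0 k.+1; have := d_gt0 k.+2; nra.
by move=> mn; apply: le_trans (ni _ _ mn); rewrite lerDl mulr_ge0// ltW.
Qed.

Let iota_cvg t : cvgn (iota_part ^~ t).
Proof.
apply: nondecreasing_is_cvgn; first exact: iota_part_nd.
by exists (iota_part 0 t + 2 * d 1) => _ [n _ <-]; exact: iota_part_ub.
Qed.

Let iota (t : R) : R := limn (iota_part ^~ t).

Let iota_lb m t : iota_part m t <= iota t.
Proof. by apply: nondecreasing_cvgn_le. Qed.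

Let iota_ub m t : iota t <= iota_part m t + 2 * d m.+1.
Proof.
by apply: limr_le => //; exists m => // n /= mn; exact: iota_part_ub.
Qed.

Let iota_ge0 t : 0 <= iota t.
Proof. by rewrite (le_trans _ (iota_lb 0 t))// /iota_part big_ord0. Qed.

Let iota_lt1 t : iota t < 1.
Proof.
rewrite (le_lt_trans (iota_ub 0 t))// /iota_part big_ord0.
have := d_growth 0; have : d 0 = 1 by rewrite /d q_0 invr1.
by have := d_gt0 1; lra.
Qed.

Let iotaD1 t : iota (t + 1) = iota t.
Proof.
by rewrite /iota /iota_part; under eq_fun do under eq_bigr do rewrite digitD1.
Qed.

Let iota_lt s t : Num.floor s = Num.floor t -> s < t -> iota s < iota t.
Proof.
move=> st0 st; have [k hlt hk] := digit_first_diff st0 st.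
have E : iota_part k s = iota_part k t.
  by apply: eq_bigr => j _; rewrite hlt.
have ds0 : digit k s = 0 by have := digit_ge0 k s; have := digit_le1 k t; lia.
have dt1 : digit k t = 1 by have := digit_ge0 k s; have := digit_le1 k t; lia.
rewrite (le_lt_trans (iota_ub k.+1 s))// (lt_le_trans _ (iota_lb k.+1 t))//.
rewrite !iota_partS ds0 dt1 E mul0r mul1r addr0 ltrD2l.
by have := d_growth k.+1; have := d_gt0 k.+2; lra.
Qed.

Let iota_part_int m t : (q m)%:R * iota_part m t \is a Num.int.
Proof.
rewrite mulr_sumr rpred_sum// => j _.
rewrite mulrC -mulrA rpredM ?intr_int//.
have jm : (q j.+1 %| q m)%N.
  move: (j.+1) (ltn_ord j : (j.+1 <= m)%N) => i.
  elim: {j}m => [|m IHm]; first by rewrite leqn0 => /eqP->.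
  rewrite leq_eqVlt => /orP[/eqP->//|/IHm h].
  exact: dvdn_trans h (q_dvd _).
by rewrite -(divnK jm) natrM mulrC mulfK ?pnatr_eq0 -?lt0n// natr_int.
Qed.

Let kappa (t : R) : R := iota t + (Num.floor t)%:~R * alpha.

Let kappa_measurable : measurable_fun setT kappa.
Proof.
apply: measurable_funD.
  apply: (@measurable_fun_cvg _ _ _ _ (fun m t => iota_part m t)) => [m|t _].
    apply: measurable_sum => j; apply: measurable_funM => //.
    exact: measurable_digit.
  exact: iota_cvg.
apply: measurable_funM => //.
by apply: nondecreasing_measurable => // s t st; rewrite ler_int le_floor.
Qed.

(* Up to an error of 2 / q N.+1, the values of iota are fractions of
   denominator q N, which the choice of q N.+1 keeps away from j * alpha. *)
Let kappa_sep N : exists2 e : R, 0 < e & forall s t (l : int),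
  Num.floor s != Num.floor t -> (`|(Num.floor s - Num.floor t)%R| <= N)%N ->
  e <= `|kappa s - kappa t - l%:~R|.
Proof.
exists (2 * d N.+1); first by rewrite mulr_gt0.
move=> s t l; rewrite -subr_eq0; set j := Num.floor s - _ => j0 jN.
have /intrP[a ha] := iota_part_int N s; have /intrP[b hb] := iota_part_int N t.
have q0 k : (0 : R) < (q k)%:R by rewrite ltr0n.
have := q_sep (Posz (q N) * l - a + b) j0 jN.
rewrite (_ : (Posz (q N) * l - a + b)%:~R =
    (q N)%:R * l%:~R - a%:~R + b%:~R :> R); last by rewrite !(rmorphD, rmorphN, rmorphM)/=.
rewrite -ha -hb.
rewrite [X in `|X|](_ : _ = (q N)%:R *
    (iota_part N s - iota_part N t + j%:~R * alpha - l%:~R)); last first.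
  by ring.
rewrite normrM gtr0_norm// mulrCA [leLHS]mulrC ler_pM2l//.
rewrite -ler_pdivrMl// -/(d _) => h.
have := iota_lb N s; have := iota_lb N t.
have := iota_ub N s; have := iota_ub N t.
rewrite [X in _ <= `|X|](_ : _ =
    (iota_part N s - iota_part N t + j%:~R * alpha - l%:~R) -
    ((iota t - iota_part N t) - (iota s - iota_part N s))); last first.
  by rewrite /kappa /j rmorphB/=; ring.
move=> h1 h2 h3 h4; rewrite (le_trans _ (lerB_dist _ _))//.
have : `|iota t - iota_part N t - (iota s - iota_part N s)| <= 2 * d N.+1.
  by rewrite ler_norml; lra.
by move: h; lra.
Qed.

Let kappa_small e : 0 < e -> exists2 r : R, 0 < r &
  forall t, 0 <= t < r -> 0 <= kappa t < e.
Proof.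
move=> e0; pose k := Num.bound (2 / e).
have qk : (k < q k.+1)%N.
  have : forall j, (j < q j)%N.
    elim=> [|j IH]; first by rewrite q_0.
    by have := q_growth j; lia.
  by move/(_ k.+1); lia.
have dk : 2 * d k.+1 < e.
  rewrite /d ltr_pdivrMr ?ltr0n// mulrC -ltr_pdivrMr//.
  rewrite (lt_trans (archi_boundP _)) ?ltr_nat//.
  by rewrite divr_ge0// ltW.
exists (2 ^- k) => [|t /andP[t0 tk]]; first by rewrite invr_gt0 exprn_gt0.
have p0 j : (0 : R) < 2 ^+ j by rewrite exprn_gt0.
have tk1 : 2 ^+ k * t < 1 by rewrite mulrC -ltr_pdivlMr// mul1r.
have t1 : Num.floor t = 0.
  apply: floor_def; rewrite t0/= (lt_le_trans tk)// invf_le1//.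
  by rewrite exprn_ege1//; lra.
have -> : kappa t = iota t by rewrite /kappa t1 mul0r addr0.
rewrite iota_ge0/= (le_lt_trans (iota_ub k t))//.
rewrite {1}/iota_part big1 ?add0r// => j _.
rewrite digit_small ?mul0r// (le_lt_trans _ tk1)// ler_wpM2r//.
by apply: ler_weXn2l; [lra|exact: ltn_ord].
Qed.

Lemma orbit_parametrization_of_denominators :
  exists kappa, orbit_parametrization alpha kappa.
Proof.
exists kappa; split => // [t|s t st].
  rewrite /kappa iotaD1 floorDrz// floor1 rmorphD/=; ring.
rewrite /kappa st opprD addrACA subrr addr0 => /intrP[n hn].
have n0 : n = 0.
  have := iota_ge0 s; have := iota_ge0 t; have := iota_lt1 s.
  have := iota_lt1 t => h1 h2 h3 h4.
  have : (-1)%:~R < n%:~R :> R by rewrite -hn; lra.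
  have : n%:~R < 1%:~R :> R by rewrite -hn; lra.
  by rewrite !ltr_int; lia.
move: hn; rewrite n0 => /eqP; rewrite subr_eq0 => /eqP E.
have [/(iota_lt st)|/(iota_lt (esym st))|//] := ltgtP s t.
  by rewrite E ltxx.
by rewrite E ltxx.
Qed.

End Kappa.

Lemma exists_orbit_parametrization (R : realType) (alpha : R) :
  irrational alpha -> exists kappa, orbit_parametrization alpha kappa.
Proof.
by move=> /sparse_denominators[q [? ? ? ? ?]];
  exact: (@orbit_parametrization_of_denominators R alpha q).
Qed.

(** * A density with a continuous cocycle *)

Section GeometricSeries.
Variable R : realType.

Lemma cvg_series_half (u : nat -> R) (c : R) :
  (forall k, `|u k| <= c * 2^-1 ^+ k) -> cvgn (series u).
Proof.
move=> uc; apply: normed_cvg.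
apply: (@series_le_cvg _ _ (fun k => c * 2^-1 ^+ k)) => [k|k|k|].
- exact: normr_ge0.
- exact: le_trans (uc k).
- exact: uc.
- by apply: is_cvg_geometric_series; rewrite gtr0_norm; lra.
Qed.

Lemma series_half_tail (u : nat -> R) (c : R) n :
  (forall k, `|u k| <= c * 2^-1 ^+ k) ->
  `|limn (series u) - series u n| <= 2 * c * 2^-1 ^+ n.
Proof.
move=> uc; have cu := cvg_series_half uc.
have c0 : 0 <= c by have := uc 0%N; rewrite expr0 mulr1; exact: le_trans.
have h m : (n <= m)%N ->
    `|series u m - series u n| <= 2 * c * 2^-1 ^+ n - 2 * c * 2^-1 ^+ m.
  elim: m => [|m IH]; first by rewrite leqn0 => /eqP->; rewrite !subrr normr0.
  rewrite leq_eqVlt => /orP[/eqP<-|]; first by rewrite !subrr normr0.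
  rewrite ltnS => /IH h; rewrite [series u m.+1]seriesSr.
  rewrite (_ : _ - _ = (series u m - series u n) + u m); last by ring.
  apply: le_trans (ler_normD _ _) _.
  have := uc m; rewrite [2^-1 ^+ m.+1]exprS; lra.
have cn : `|series u m - series u n| @[m --> \oo] -->
    `|limn (series u) - series u n|.
  by apply: cvg_norm; apply: cvgB => //; exact: cvg_cst.
rewrite -(cvg_lim _ cn)//; apply: limr_le; first by apply/cvg_ex; eexists; exact: cn.
exists n => // m /= nm; apply: le_trans (h m nm) _.
by rewrite gerBl !mulr_ge0// exprn_ge0.
Qed.

Lemma continuous_series_half (u : nat -> R -> R) :
  (forall k, continuous (u k)) -> (forall k x, `|u k x| <= 2^-1 ^+ k) ->
  continuous (fun x => limn (series (u ^~ x))).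
Proof.
move=> uC ub x.
have ub' y k : `|u k y| <= 1 * 2^-1 ^+ k by rewrite mul1r.
have sC n : continuous (fun y => series (u ^~ y) n).
  elim: n => [|n IH] y.
    by rewrite /series /=; under eq_fun do rewrite big_geq//; exact: cvg_cst.
  under eq_fun do rewrite seriesSr; apply: cvgD; [exact: IH|exact: uC].
apply/cvgrPdist_lt => e e0.
have [n hn] : exists n, 2 * 1 * 2^-1 ^+ n < e / 3 :> R.
  have : 2 * 1 * 2^-1 ^+ n @[n --> \oo] --> (0 : R).
    by apply: cvg_geometric; rewrite gtr0_norm; lra.
  move/cvgrPdist_lt => /(_ (e / 3)); rewrite divr_gt0// => /(_ isT)[n _ hn].
  exists n; move: (hn n (leqnn _)); rewrite /= sub0r normrN; apply: le_lt_trans.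
  exact: ler_norm.
have e3 : 0 < e / 3 by rewrite divr_gt0.
have /cvgrPdist_lt/(_ _ e3) := sC n x; apply: filterS => y hy.
have := series_half_tail n (ub' x); have := series_half_tail n (ub' y).
rewrite distrC => h1 h2.
rewrite (_ : _ - _ = (limn (series (u ^~ x)) - series (u ^~ x) n) +
  (series (u ^~ x) n - series (u ^~ y) n) +
  (series (u ^~ y) n - limn (series (u ^~ y)))); last by ring.
have := ler_normD (limn (series (u ^~ x)) - series (u ^~ x) n)
  (series (u ^~ x) n - series (u ^~ y) n).
have := ler_normD ((limn (series (u ^~ x)) - series (u ^~ x) n) +
  (series (u ^~ x) n - series (u ^~ y) n))
  (series (u ^~ y) n - limn (series (u ^~ y))).
by lra.
Qed.

End GeometricSeries.

Section Gauge.
Variables (R : realType) (alpha : R) (kappa : R -> R).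
Hypothesis hk : orbit_parametrization alpha kappa.

Lemma kappaDz t (n : int) : kappa (t + n%:~R) = kappa t + n%:~R * alpha.
Proof. by have [_ kD _ _ _] := hk; exact: shift_int. Qed.

(** The least cost of reaching x modulo 1 from the Cantor set, where a step
    along an orbit costs e and a displacement costs lam per unit of length.
    As an infimum of such costs it changes by at most e under the rotation and
    is lam-Lipschitz. *)
Definition gauge (e lam x : R) : R :=
  inf [set r | exists t (l : int),
    r = e * `|(Num.floor t)%:~R| + lam * `|x - kappa t - l%:~R|].

Variables (e lam : R).
Hypotheses (e0 : 0 <= e) (lam0 : 0 <= lam).

Lemma gauge_le x t (l : int) :
  gauge e lam x <= e * `|(Num.floor t)%:~R| + lam * `|x - kappa t - l%:~R|.
Proof.
apply: ge_inf; last by exists t, l.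
by exists 0 => _ [s [m ->]]; rewrite addr_ge0// mulr_ge0.
Qed.

Lemma le_gauge x c :
  (forall t (l : int),
    c <= e * `|(Num.floor t)%:~R| + lam * `|x - kappa t - l%:~R|) ->
  c <= gauge e lam x.
Proof.
move=> h; apply: lb_le_inf; first by eexists; exists 0, 0.
by move=> _ [t [l ->]].
Qed.

Lemma gauge_ge0 x : 0 <= gauge e lam x.
Proof. by apply: le_gauge => t l; rewrite addr_ge0// mulr_ge0. Qed.

Lemma gaugeD1 x : gauge e lam (x + 1) = gauge e lam x.
Proof.
apply/eqP; rewrite eq_le; apply/andP; split; apply: le_gauge => t l.
  apply: le_trans (gauge_le _ t (l + 1)) _.
  by rewrite rmorphD/= (_ : x + 1 - _ - _ = x - kappa t - l%:~R)//; ring.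
apply: le_trans (gauge_le _ t (l - 1)) _.
by rewrite rmorphB/= (_ : x - _ - (_ - _) = x + 1 - kappa t - l%:~R)//; ring.
Qed.

Lemma gauge_lip x y : `|gauge e lam x - gauge e lam y| <= lam * `|x - y|.
Proof.
have h a b : gauge e lam a <= gauge e lam b + lam * `|a - b|.
  rewrite -lerBlDr; apply: le_gauge => t l; rewrite lerBlDr.
  apply: le_trans (gauge_le a t l) _; rewrite -[leRHS]addrA lerD2l -mulrDr ler_wpM2l//.
  by rewrite (_ : a - _ - _ = (b - kappa t - l%:~R) + (a - b)) ?ler_normD//; ring.
rewrite ler_norml; have := h x y; have := h y x; rewrite distrC; lra.
Qed.

Lemma gauge_step x : `|gauge e lam x - gauge e lam (x + alpha)| <= e.
Proof.
have [_ kD _ _ _] := hk.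
have fl (t : R) (n : int) : `|(Num.floor (t + n%:~R))%:~R| <=
    `|(Num.floor t)%:~R| + `|n%:~R| :> R.
  by rewrite floorDrz ?intr_int// intrKfloor rmorphD ler_normD.
have h1 : gauge e lam (x + alpha) <= gauge e lam x + e.
  rewrite -lerBlDr; apply: le_gauge => t l; rewrite lerBlDr.
  apply: le_trans (gauge_le _ (t + 1%:~R) l) _.
  rewrite kappaDz (_ : x + _ - _ - _ = x - kappa t - l%:~R); last by ring.
  by have := fl t 1; rewrite normr1 => /(ler_wpM2l e0); lra.
have h2 : gauge e lam x <= gauge e lam (x + alpha) + e.
  rewrite -lerBlDr; apply: le_gauge => t l; rewrite lerBlDr.
  apply: le_trans (gauge_le _ (t + (-1)%:~R) l) _.
  rewrite kappaDz (_ : x - _ - _ = x + alpha - kappa t - l%:~R); last by ring.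
  by have := fl t (-1); rewrite normrN1 => /(ler_wpM2l e0); lra.
by rewrite ler_norml; lra.
Qed.

Lemma gauge_orbit_le t : gauge e lam (kappa t) <= e * `|(Num.floor t)%:~R|.
Proof.
by have := gauge_le (kappa t) t 0; rewrite subrr subr0 normr0 mulr0 addr0.
Qed.

(** The only way to save on the |n| steps that lead to the n-th rotate of the
    set is to start from an m-th rotate with |m| < |n|; the displacement between
    the two rotates is then at least eta and costs at least L. *)
Lemma gauge_orbit_ge (M : nat) (eta L : R) :
  (forall s t (l : int), Num.floor s != Num.floor t ->
     (`|(Num.floor s - Num.floor t)%R| <= 2 * M)%N ->
     eta <= `|kappa s - kappa t - l%:~R|) ->
  L <= lam * eta ->
  forall t, (`|Num.floor t| <= M)%N ->
  Num.min (e * `|(Num.floor t)%:~R|) L <= gauge e lam (kappa t).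
Proof.
move=> sep Leta t tM; apply: le_gauge => s l; rewrite ge_min.
have [le_ts|lt_st] := leqP `|Num.floor t| `|Num.floor s|.
  apply/orP; left; rewrite -[leLHS]addr0 lerD ?mulr_ge0// ler_wpM2l//.
  by rewrite -!intr_norm ler_int; lia.
apply/orP; right; apply: le_trans Leta _.
rewrite -[leLHS]add0r lerD ?mulr_ge0// ler_wpM2l//.
apply: sep; first by apply: contraL lt_st => /eqP->; rewrite ltnn.
by lia.
Qed.

End Gauge.

Section Weight.
Variables (R : realType) (alpha : R) (kappa : R -> R).
Hypothesis hk : orbit_parametrization alpha kappa.

Lemma expR_ge_pow (x : R) (n : nat) : 0 <= x -> (x / n.+1%:R) ^+ n.+1 <= expR x.
Proof.
move=> x0; have -> : expR x = expR (x / n.+1%:R) ^+ n.+1.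
  by rewrite -expRM_natl mulrC divfK// pnatr_eq0.
apply: lerXn2r; rewrite ?nnegrE ?divr_ge0 ?expR_ge0//.
by apply: le_trans (expR_ge1Dx _); rewrite lerDr.
Qed.

(* For |n| >= 4 ^ (k + 2) the cost e k * |n| of n steps is at least 2 * ln |n|,
   and the bound L k on the savings is at least 2 * ln |n| for |n| <= M k. *)
Let M k : nat := (4 ^ k.+3)%N.
Let e k : R := 2^-1 ^+ k.
Let L k : R := 2 * (M k)%:R.

Let exists_lam : exists lam : nat -> R, forall k, 0 <= lam k /\
  forall t, (`|Num.floor t| <= M k)%N ->
  Num.min (e k * `|(Num.floor t)%:~R|) (L k) <=
    gauge kappa (e k) (lam k) (kappa t).
Proof.
suff /choice[lam hlam] : forall k, exists lam : R, 0 <= lam /\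
    forall t, (`|Num.floor t| <= M k)%N ->
    Num.min (e k * `|(Num.floor t)%:~R|) (L k) <= gauge kappa (e k) lam (kappa t).
  by exists lam.
move=> k; have [_ _ _ /(_ (2 * M k)%N)[eta eta0 sep] _] := hk.
have l0 : 0 <= L k / eta by rewrite divr_ge0 ?mulr_ge0// ltW.
exists (L k / eta); split => // t tM.
apply: (@gauge_orbit_ge _ kappa _ _ _ _ (M k) eta) => //.
  by rewrite exprn_ge0.
by rewrite divfK// gt_eqF.
Qed.

(** The weight W decays along the orbits fast enough to be integrable, and yet
    one step along an orbit multiplies it by a continuous function of the point,
    although the orbits are dense.  Its logarithm is minus a sum of gauges.  The
    change of the k-th one in a step is at most 2 ^- k, whence a uniformly
    convergent series for ln phi.  On the n-th rotate of the set, where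
    4 ^ (k + 2) <= |n| <= 4 ^ (k + 3), the k-th gauge alone is at least
    2 * ln |n|. *)
Lemma exists_weight : exists W phi : R -> R,
  [/\ measurable_fun setT W,
      forall t, 0 < W t <= 290 * (oneDsqr t)^-1,
      forall t, W (t + 1) = phi (kappa t) * W t,
      continuous phi &
      forall x, 0 < phi x /\ phi (x + 1) = phi x].
Proof.
have [mk kD _ _ _] := hk; have [lam hlam] := exists_lam.
pose g k x := gauge kappa (e k) (lam k) x.
have e0 k : 0 <= e k by rewrite exprn_ge0.
have lam0 k : 0 <= lam k by have [] := hlam k.
have g0 k x : 0 <= g k x by exact: (gauge_ge0 kappa (e0 k) (lam0 k)).
have gC k : continuous (g k).
  move=> x; apply/cvgrPdist_lt => r r0; near=> y.
  rewrite (le_lt_trans (gauge_lip kappa (e0 k) (lam0 k) _ _))//.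
  rewrite (@le_lt_trans _ _ ((lam k + 1) * `|x - y|))//.
    by rewrite ler_wpM2r// lerDl.
  rewrite -ltr_pdivlMl; last by rewrite ltr_wpDl.
  near: y; apply/nbhs_ballP; exists ((lam k + 1)^-1 * r) => //=.
  by rewrite mulr_gt0// invr_gt0 ltr_wpDl.
pose u k x := g k x - g k (x + alpha).
have ub k x : `|u k x| <= 2^-1 ^+ k by exact: (gauge_step hk (e0 k) (lam0 k)).
have uC k : continuous (u k).
  move=> x; apply: cvgB; first exact: gC.
  apply: (@continuous_comp _ _ _ (fun y => y + alpha) (g k)); last exact: gC.
  by apply: cvgD; [exact: cvg_id|exact: cvg_cst].
have gub k t : `|g k (kappa t)| <= `|(Num.floor t)%:~R| * 2^-1 ^+ k.
  by rewrite ger0_norm// mulrC; exact: (gauge_orbit_le kappa (e0 k) (lam0 k)).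
have gcv t := cvg_series_half (gub ^~ t).
have ucv x : cvgn (series (u ^~ x)).
  by apply: (@cvg_series_half _ _ 1) => k; rewrite mul1r.
(* the gauges vanish on the Cantor set itself and are finite on its orbits *)
pose W t := expR (- limn (series (fun k => g k (kappa t)))).
pose phi x := expR (limn (series (u ^~ x))).
have Wn t k : W t <= expR (- g k (kappa t)).
  rewrite ler_expR lerN2.
  apply: le_trans (nondecreasing_cvgn_le _ (gcv t) k.+1); last first.
    by apply: nondecreasing_series.
  by rewrite seriesSr lerDr sumr_ge0.
exists W, phi; split.
- apply: measurableT_comp => //; apply: measurableT_comp => //.
  apply: (@measurable_fun_cvg _ _ _ _
    (fun n t => series (fun k => g k (kappa t)) n)) => [n|t _]; last exact: gcv.
  apply: measurable_sum => k; apply: measurableT_comp => //.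
  exact: continuous_measurable_fun.
- move=> t; rewrite expR_gt0/= ler_pdivlMr ?oneDsqr_gt0// /oneDsqr.
  have W0 : 0 <= W t by exact: expR_ge0.
  have /andP[t1 t2] := floor_itv t.
  (* 290 is ample: |t| <= 16 in the first case, where only W t <= 1 is known *)
  have [n16|n16] := ltnP `|Num.floor t| 16.
    have W1 : W t <= 1.
      by rewrite (le_trans (Wn t 0%N))// -expR0 ler_expR oppr_le0.
    have : (-16)%:~R <= (Num.floor t)%:~R :> R by rewrite ler_int; lia.
    have : (Num.floor t + 1)%:~R <= 16%:~R :> R by rewrite ler_int; lia.
    by move=> h1 h2; nra.
  set n := Num.floor t in t1 t2 n16 *.
  pose k := (trunc_log 4 `|n|).-2.
  have k2 : (trunc_log 4 `|n| = k.+2)%N.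
    have : (2 <= trunc_log 4 `|n|)%N by apply: trunc_log_max.
    by rewrite /k; case: trunc_log => [|[]].
  have nlo : (4 ^ k.+2 <= `|n|)%N by rewrite -k2 trunc_logP//; lia.
  have nhi : (`|n| <= M k)%N by rewrite /M -k2 ltnW// trunc_log_ltn.
  pose a : R := `|n|%N%:R.
  have a16 : 16 <= a by rewrite ler_nat.
  have aE : `|n%:~R| = a :> R by rewrite -intr_norm /a natr_absz.
  have hW : W t * a ^+ 2 <= 1.
    suff h : a ^+ 2 <= expR (g k (kappa t)).
      rewrite -(mulVf (lt0r_neq0 (expR_gt0 (g k (kappa t))))) -expRN.
      by apply: ler_pM => //; exact: sqr_ge0.
    have [_ /(_ t nhi)] := hlam k.
    rewrite -/n aE ge_min => /orP[h|h].
    + apply: le_trans (_ : expR (e k * a) <= _); last by rewrite ler_expR.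
      apply: le_trans (expR_ge_pow 3 (mulr_ge0 (e0 k) _)) => //.
      have h16 : 16 <= e k ^+ 2 * a.
        have -> : (16 : R) = e k ^+ 2 * (4 ^ k.+2)%:R.
          have : e k ^+ 2 * 4 ^+ k = 1.
            rewrite /e -exprM mulnC exprM -exprMn.
            by rewrite (_ : 2^-1 ^+ 2 * 4 = 1) ?expr1n//; field.
          rewrite natrX [4 ^+ k.+2]exprS [4 ^+ k.+1]exprS => h1.
          by transitivity (16 * (e k ^+ 2 * 4 ^+ k)); [rewrite h1 mulr1|ring].
        by rewrite ler_wpM2l ?sqr_ge0// ler_nat.
      rewrite (_ : _ ^+ 4 = (e k ^+ 2 * a) ^+ 2 / 256 * a ^+ 2); last by field.
      rewrite -[leLHS]mul1r ler_wpM2r ?sqr_ge0// ler_pdivlMr// mul1r.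
      by move: (e k ^+ 2 * a) h16 => z; nra.
    + apply: le_trans (_ : expR (L k) <= _); last by rewrite ler_expR.
      have L0 : 0 <= L k by rewrite mulr_ge0.
      apply: le_trans (expR_ge_pow 1 L0); rewrite /L mulrC mulKf ?pnatr_eq0//.
      by rewrite ler_sqr ?nnegrE// ler_nat.
  have ta : t ^+ 2 <= (a + 1) ^+ 2.
    have : `|t| <= a + 1.
      move: t2; rewrite -aE rmorphD/= => t2.
      by rewrite (_ : t = n%:~R + (t - n%:~R)) 1?(le_trans (ler_normD _ _))
        ?lerD2l ?ler_norml; lra.
    by move=> h; rewrite -(real_normK (num_real t)); apply: lerXn2r;
      rewrite ?nnegrE//; lra.
  have : W t * t ^+ 2 <= W t * (a + 1) ^+ 2 by rewrite ler_wpM2l.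
  have : W t * 1 <= W t * a by rewrite ler_wpM2l//; lra.
  have : W t * a <= W t * a ^+ 2 by rewrite ler_wpM2l//; nra.
  by lra.
- move=> t; have h : limn (series (u ^~ (kappa t))) =
      limn (series (fun k => g k (kappa t))) -
      limn (series (fun k => g k (kappa (t + 1)))).
    rewrite -(limB (gcv _) (gcv _)); congr (limn _); apply/funext => n.
    by rewrite !fctE /series/= -sumrB; apply: eq_bigr => k _; rewrite /u kD.
  by rewrite /W /phi -expRD h; congr expR; ring.
- move=> x; apply: (@continuous_comp _ _ _ (fun y => limn (series (u ^~ y))) expR).
    exact: continuous_series_half.
  exact: continuous_expR.
- move=> x; split; first exact: expR_gt0.
  congr (expR (limn (series _))); apply/funext => k.
  by rewrite /u addrAC /g !(gaugeD1 kappa (e0 k) (lam0 k)).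
Unshelve. all: by end_near. Qed.

End Weight.

(** * Integration on the line *)

Section RealIntegrals.
Variable R : realType.
Notation mu := (@lebesgue_measure R).

Lemma lebesgue_measure_shift (c : R) (A : set R) : measurable A ->
  pushforward mu (fun x : measurableTypeR R => x + c : measurableTypeR R) A = mu A.
Proof.
move=> mA; have mc : measurable_fun [set: measurableTypeR R]
    (fun x : measurableTypeR R => x + c : measurableTypeR R).
  by apply: measurable_funD.
pose nu : {measure set (measurableTypeR R) -> \bar R} :=
  measure_function_pushforward__canonical__measure_function_Measure mu mc.
rewrite -[LHS]/(nu A); symmetry; apply: lebesgue_measure_unique => //.
move=> _ [[a b] _ <-] /=; rewrite /pushforward.
rewrite (_ : _ @^-1` _ = `]a - c, b - c]%classic); last first.
  by apply/seteqP; split => x /=; rewrite !in_itv/= ltrBlDr lerBrDr.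
rewrite !lebesgue_measure_itv/= !lte_fin ltrD2r.
by case: ifP => // _; rewrite -!EFinB; congr (_%:E); ring.
Qed.

Lemma Rintegral_shift (f : R -> R) (c : R) : mu.-integrable setT (EFin \o f) ->
  mu.-integrable setT (EFin \o (fun t => f (t + c))) ->
  \int[mu]_t f (t + c) = \int[mu]_t f t.
Proof.
move=> intf intfc; congr fine.
have mc : measurable_fun [set: measurableTypeR R]
    (fun x : measurableTypeR R => x + c : measurableTypeR R).
  by apply: measurable_funD.
have := @integral_pushforward _ _ _ _ R _ mc mu setT (EFin \o f) _ _ measurableT.
rewrite preimage_setT => <- //; last exact: measurable_int intf.
by apply: eq_measure_integral => A mA _; exact: lebesgue_measure_shift.
Qed.

Lemma integrable_oneDsqrV : mu.-integrable setT (EFin \o (fun t => (oneDsqr t)^-1)).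
Proof.
have h0 (t : R) : 0 <= (oneDsqr t)^-1 by rewrite invr_ge0 ltW// oneDsqr_gt0.
apply/integrableP; split.
  by apply/measurable_EFinP; apply: continuous_measurable_fun;
    exact: continuous_oneDsqrV.
under eq_integral => t _ do rewrite /= ger0_norm//.
rewrite (@ge0_symfun_integralT _ (fun t => (oneDsqr t)^-1))//.
- by rewrite -set_itvcy integral0y_oneDsqr -EFinM ltry.
- exact: continuous_oneDsqrV.
- by move=> t; rewrite /oneDsqr /= sqrrN.
Qed.

Lemma Rintegral_gt0 (f : R -> R) (a b : R) : a < b ->
  mu.-integrable setT (EFin \o f) -> (forall t, 0 <= f t) ->
  (forall t, a < t < b -> 0 < f t) -> 0 < \int[mu]_t f t.
Proof.
move=> ab intf f0 fab; rewrite lt_neqAle Rintegral_ge0// andbT eq_sym.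
apply/eqP => h.
have /measurable_int mf := intf.
have : (\int[mu]_t `|(f t)%:E| = 0)%E.
  under eq_integral => t _ do rewrite gee0_abs ?lee_fin//.
  rewrite -[LHS]fineK; last exact: (integrable_fin_num _ intf).
  by congr (_%:E).
move/(ae_eq_integral_abs _ measurableT mf) => hae.
have hn : mu.-negligible `]a, b[%classic.
  apply: negligibleS hae => t /=; rewrite in_itv/= => tab /(_ Logic.I) [].
  by move=> ft; have := fab t tab; rewrite ft ltxx.
have /eqP : mu `]a, b[%classic = 0%E.
  by apply: measure_negligible hn; exact: measurable_itv.
by rewrite lebesgue_measure_itv/= lte_fin ab -EFinB eqe subr_eq0 gt_eqF.
Qed.

Lemma measurable_floorR : measurable_fun setT (fun x : R => (Num.floor x)%:~R : R).
Proof.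
by apply: nondecreasing_measurable => // s t st; rewrite ler_int le_floor.
Qed.

Lemma cvg_floor (u : nat -> R) (x : R) : x \isn't a Num.int ->
  u @ \oo --> x -> (Num.floor (u n))%:~R @[n --> \oo] --> ((Num.floor x)%:~R : R).
Proof.
move=> xint ux; have [e e0 he] := dist_int_gt0 xint.
apply: cvg_near_cst; have /cvgrPdist_lt/(_ _ e0) := ux.
apply: filterS => n hn; congr (_%:~R); apply: floor_def.
have := he (Num.floor x); have := he (Num.floor x + 1).
have /andP[f1 f2] := floor_itv x.
rewrite (ler0_norm (_ : x - (Num.floor x + 1)%:~R <= 0)); last by rewrite subr_le0 ltW.
rewrite (ger0_norm (_ : 0 <= x - (Num.floor x)%:~R)); last by rewrite subr_ge0.
by move: hn; rewrite ltr_norml; lra.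
Qed.

End RealIntegrals.
Arguments measurable_floorR {R}.

(** W is a probability density on the parameter line, and phi becomes the
    derivative of the diffeomorphism after the change of coordinate. *)
Definition orbit_density (R : realType) (kappa W phi : R -> R) :=
  [/\ lebesgue_measure.-integrable setT (EFin \o W),
      forall t, 0 < W t,
      \int[lebesgue_measure]_t W t = 1,
      forall t, W (t + 1) = phi (kappa t) * W t &
      continuous phi /\ forall x, 0 < phi x /\ phi (x + 1) = phi x].

Lemma exists_orbit_density (R : realType) (alpha : R) (kappa : R -> R) :
  orbit_parametrization alpha kappa ->
  exists W phi, orbit_density kappa W phi.
Proof.
move=> hk; have [W [phi [mW Wb WD phiC phi0]]] := exists_weight hk.
have W0 t : 0 < W t by have /andP[] := Wb t.
have int290 : lebesgue_measure.-integrable setT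
    (EFin \o (fun t : R => 290 * (oneDsqr t)^-1)).
  exact: (integrableZl measurableT 290 (integrable_oneDsqrV R)).
have intW : lebesgue_measure.-integrable setT (EFin \o W).
  apply: (le_integrable measurableT _ _ int290); first exact/measurable_EFinP.
  move=> t _; have /andP[_ h] := Wb t.
  by rewrite lee_fin (ger0_norm (ltW (W0 t))) (le_trans h)// ler_norm.
have I0 : 0 < \int[lebesgue_measure]_t W t.
  by apply: (@Rintegral_gt0 _ _ 0 1) => // t; exact: ltW.
pose I := \int[lebesgue_measure]_t W t.
exists (fun t => I^-1 * W t), phi; split => //.
- exact: (integrableZl measurableT I^-1 intW).
- by move=> t; rewrite mulr_gt0// invr_gt0.
- by rewrite RintegralZl// mulVf// gt_eqF.
- by move=> t; rewrite WD mulrCA.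
Qed.

(** * The distribution function of the conformal measure *)

Section OrbitCdf.
Variables (R : realType) (alpha : R) (kappa W phi : R -> R).
Hypothesis hk : orbit_parametrization alpha kappa.
Hypothesis hW : orbit_density kappa W phi.
Notation mu := (@lebesgue_measure R).

Let kappa_measurable : measurable_fun setT kappa. Proof. by have [] := hk. Qed.

Let W_integrable : mu.-integrable setT (EFin \o W). Proof. by have [] := hW. Qed.

Let W_measurable : measurable_fun setT W.
Proof. by apply/measurable_EFinP; exact: (measurable_int mu W_integrable). Qed.

Let W_gt0 t : 0 < W t. Proof. by have [_ + _ _ _] := hW; apply. Qed.

Let W_ge0 t : 0 <= W t. Proof. exact: ltW. Qed.

Let floor_sub_measurable x :
  measurable_fun setT (fun t => (Num.floor (x - kappa t))%:~R : R).
Proof.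
apply: (measurableT_comp measurable_floorR).
exact: measurable_funB (measurable_cst _) kappa_measurable.
Qed.

(** For x >= 0, the number of integers l such that kappa t + l lies in
    [[0, x]]. *)
Definition orbit_count (x t : R) : int :=
  Num.floor (x - kappa t) + Num.floor (kappa t) + 1.

Lemma orbit_count_norm x t : `|(orbit_count x t)%:~R| <= `|x| + 1 :> R.
Proof.
have /andP[a1 a2] := floor_itv (x - kappa t).
have /andP[b1 b2] := floor_itv (kappa t).
move: a1 a2 b1 b2; rewrite /orbit_count !rmorphD/= => a1 a2 b1 b2.
rewrite ler_norml; have := ler_norm x; have := ler_norm (- x); rewrite normrN.
by move=> *; apply/andP; split; lra.
Qed.

Lemma orbit_countB x y t : orbit_count y t - orbit_count x t =
  Num.floor (y - kappa t) - Num.floor (x - kappa t).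
Proof. by rewrite /orbit_count; ring. Qed.

Lemma orbit_count_measurable x :
  measurable_fun setT (fun t => (orbit_count x t)%:~R : R).
Proof.
rewrite [X in measurable_fun _ X](_ : _ = fun t => (Num.floor (x - kappa t))%:~R +
    (Num.floor (kappa t))%:~R + 1); last first.
  by apply/funext => t; rewrite /orbit_count !rmorphD.
apply: measurable_funD => //; apply: measurable_funD => //.
exact: (measurableT_comp measurable_floorR).
Qed.

(** On [[0, 1[ this is the distribution function of the law of kappa t modulo 1,
    where t has density W. *)
Definition orbit_cdf (x : R) : R := \int[mu]_t (W t * (orbit_count x t)%:~R).

Let le_integrableW (f : R -> R) (c : R) : measurable_fun setT f ->
  (forall t, `|f t| <= c) -> mu.-integrable setT (EFin \o (fun t => W t * f t)).
Proof.
move=> mf fc; have intc := integrableZl measurableT c W_integrable.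
apply: (le_integrable measurableT _ _ intc).
  by apply/measurable_EFinP; apply: measurable_funM.
move=> t _; rewrite /= lee_fin !normrM (ger0_norm (W_ge0 t)) mulrC ler_wpM2r//.
exact: le_trans (fc t) (ler_norm _).
Qed.

Lemma orbit_count_integrable x :
  mu.-integrable setT (EFin \o (fun t => W t * (orbit_count x t)%:~R)).
Proof.
apply: (@le_integrableW _ (`|x| + 1)); first exact: orbit_count_measurable.
exact: orbit_count_norm.
Qed.

Let floor_diff (x y t : R) : R :=
  (Num.floor (y - kappa t) - Num.floor (x - kappa t))%:~R.

Let floor_diff_integrable x y :
  mu.-integrable setT (EFin \o (fun t => W t * floor_diff x y t)).
Proof.
have := integrableB measurableT (orbit_count_integrable y) (orbit_count_integrable x).
apply: eq_integrable => // t _ /=.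
by rewrite -EFinB -mulrBr -rmorphB/= orbit_countB.
Qed.

Lemma orbit_cdfB x y : orbit_cdf y - orbit_cdf x =
  \int[mu]_t (W t * (Num.floor (y - kappa t) - Num.floor (x - kappa t))%:~R).
Proof.
rewrite /orbit_cdf -RintegralB//; try exact: orbit_count_integrable.
apply: eq_Rintegral => t _.
by rewrite -mulrBr -rmorphB/= orbit_countB.
Qed.

Let floor_diff_ge0 x y t : x <= y -> 0 <= floor_diff x y t.
Proof. by move=> xy; rewrite ler0z subr_ge0 le_floor// lerB. Qed.

Lemma orbit_cdf_nd : {homo orbit_cdf : x y / x <= y}.
Proof.
move=> x y xy; rewrite -subr_ge0 orbit_cdfB; apply: Rintegral_ge0 => t _.
by rewrite mulr_ge0//; exact: floor_diff_ge0.
Qed.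

Lemma orbit_cdfD1 x : orbit_cdf (x + 1) = orbit_cdf x + 1.
Proof.
have [_ _ W1 _ _] := hW.
rewrite -[LHS](subrK (orbit_cdf x)) addrC; congr (_ + _).
rewrite orbit_cdfB -[RHS]W1; apply: eq_Rintegral => t _.
by rewrite addrAC floorDrz// floor1 addrAC subrr add0r mulr1.
Qed.

(** There are no atoms: for given x, kappa t is congruent to x for at most one t
    in each interval [[n, n + 1[. *)
Lemma orbit_cdf_continuous : continuous orbit_cdf.
Proof.
move=> x; apply/(@cvg_nbhsP _ R^o) => w wx.
have [M hM] : exists M, forall n, `|w n| <= M.
  have [M [_ /(_ (M + 1))]] : bounded_fun w.
    by apply: cvg_seq_bounded; apply/cvg_ex; exists x.
  by rewrite ltrDl ltr01 => /(_ isT) h; exists (M + 1) => n; apply: h.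
(* off this countable set the integrand is continuous in x *)
pose A := [set t | x - kappa t \is a Num.int].
have cA : countable A.
  apply/countable_injP; exists (fun t => pickle (Num.floor t)) => s t.
  rewrite !inE /A/= => sA tA /(pcan_inj pickleK) st.
  have [_ _ inj _ _] := hk; apply: inj => //.
  by have := rpredB tA sA; rewrite opprB addrC addrA subrK.
have A0 : mu A = 0%E by exact: countable_lebesgue_measure0.
have mA : measurable (A : set (measurableTypeR R)).
  by apply: countable_measurable => // t; exact: measurable_set1.
have intM := integrableZl measurableT (M + 1) W_integrable.
have [||_ _] := @dominated_convergence _ _ _ mu setT measurableT
  (fun n => EFin \o (fun t => W t * (orbit_count (w n) t)%:~R))
  (EFin \o (fun t => W t * (orbit_count x t)%:~R)) _
  (fun n => measurable_int mu (orbit_count_integrable (w n)))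
  (measurable_int mu (orbit_count_integrable x)) _ intM _.
- exists A; split => // t /=; apply: contra_notP => tA _.
  apply: cvg_EFin; first exact: nearW.
  apply: cvgM; first exact: cvg_cst.
  rewrite /orbit_count; under eq_fun do rewrite !rmorphD/=.
  rewrite !rmorphD/=; apply: cvgD; last exact: cvg_cst.
  apply: cvgD; last exact: cvg_cst.
  apply: cvg_floor; first exact/negP.
  by apply: cvgB => //; exact: cvg_cst.
- apply: nearW => t n _ /=; rewrite lee_fin normrM (ger0_norm (W_ge0 t)) mulrC.
  by rewrite ler_wpM2r// (le_trans (orbit_count_norm _ _))// lerD2r.
move=> h; rewrite /orbit_cdf /Rintegral; apply: fine_cvg; rewrite fineK; first exact: h.
exact: integrable_fin_num (orbit_count_integrable x).
Qed.

Lemma orbit_cdf0 : orbit_cdf 0 = 0.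
Proof.
apply/eqP; rewrite eq_le; apply/andP; split.
  (* the integrand is nonpositive to the left of 0 and nonnegative at 0 *)
  have h : orbit_cdf (- n.+1%:R^-1) @[n --> \oo] --> orbit_cdf (- 0).
    apply: continuous_cvg; first exact: orbit_cdf_continuous.
    by apply: cvgN; exact: cvg_harmonic.
  rewrite -{1}oppr0 -(cvg_lim _ h)//; apply: limr_le.
    by apply/cvg_ex; eexists; exact: h.
  apply: nearW => n; have u0 : (0 : R) < n.+1%:R^-1 by rewrite invr_gt0 ltr0n.
  move: (n.+1%:R^-1) u0 => u u0; rewrite -oppr_ge0 /orbit_cdf.
  rewrite -mulN1r -RintegralZl//; last exact: orbit_count_integrable.
  apply: Rintegral_ge0 => t _.
  rewrite mulN1r -mulrN mulr_ge0// -rmorphN ler0z oppr_ge0.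
  suff : (orbit_count (- u) t)%:~R < 1%:~R :> R.
    by rewrite ltr_int; move: (orbit_count _ _) => z; lia.
  have /andP[a1 a2] := floor_itv (- u - kappa t).
  have /andP[b1 b2] := floor_itv (kappa t).
  by rewrite /orbit_count !rmorphD/= !mulr1z; lra.
apply: Rintegral_ge0 => t _; rewrite mulr_ge0// ler0z.
suff : (-1)%:~R < (orbit_count 0 t)%:~R :> R.
  by rewrite ltr_int; move: (orbit_count _ _) => z; lia.
have /andP[a1 a2] := floor_itv (0 - kappa t).
have /andP[b1 b2] := floor_itv (kappa t).
by move: a2 b2; rewrite /orbit_count !rmorphD/= mulrN1z !mulr1z; lra.
Qed.

Lemma orbit_cdf_unit z : 0 <= z < 1 -> orbit_cdf z =
  \int[mu]_t (W t * (kappa t - (Num.floor (kappa t))%:~R <= z)%R%:R).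
Proof.
move=> /andP[z0 z1]; apply: eq_Rintegral => t _; congr (_ * _).
have /andP[b1 b2] := floor_itv (kappa t); rewrite rmorphD/= in b2.
have [h|h] := leP.
  rewrite /orbit_count (_ : Num.floor (z - kappa t) = - Num.floor (kappa t)).
    by rewrite addNr add0r.
  by apply: floor_def; rewrite rmorphD rmorphN/=; lra.
rewrite /orbit_count (_ : Num.floor (z - kappa t) = - Num.floor (kappa t) - 1).
  by rewrite addrAC addrNK addNr.
by apply: floor_def; rewrite addrNK rmorphB !rmorphN/=; lra.
Qed.

(** The measure is conformal: translating an interval by s * alpha multiplies
    its measure by a mean value of c over it.  The substitution of t + s for t
    moves the translation from the interval to the density W, which answers with
    the factor c (kappa t).  The cases s = 1 and s = -1 give the derivatives of
    the diffeomorphism and of its inverse. *)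
Lemma orbit_cdf_conformal (s : int) (c : R -> R) (x y m M : R) :
  (forall t, W (t + s%:~R) = c (kappa t) * W t) -> measurable_fun setT c ->
  (forall z, 0 < c z) -> (forall z (l : int), c (z + l%:~R) = c z) ->
  x <= y -> (forall z, x <= z <= y -> m <= c z <= M) ->
  m * (orbit_cdf y - orbit_cdf x) <=
    orbit_cdf (y + s%:~R * alpha) - orbit_cdf (x + s%:~R * alpha) <=
  M * (orbit_cdf y - orbit_cdf x).
Proof.
move=> Wc mc c0 cper xy hc.
set b := s%:~R * alpha.
have E t : W (t + s%:~R) * floor_diff (x + b) (y + b) (t + s%:~R) =
    c (kappa t) * W t * floor_diff x y t.
  rewrite Wc /floor_diff (kappaDz hk) -/b.
  rewrite (_ : y + b - (kappa t + b) = y - kappa t); last by ring.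
  by rewrite (_ : x + b - (kappa t + b) = x - kappa t)//; ring.
have between t : m * (W t * floor_diff x y t) <= c (kappa t) * W t * floor_diff x y t
    <= M * (W t * floor_diff x y t).
  have [->|d0] := eqVneq (floor_diff x y t) 0; first by rewrite !mulr0 lexx.
  have W0 : 0 <= W t * floor_diff x y t by rewrite mulr_ge0// floor_diff_ge0.
  suff /andP[h1 h2] : m <= c (kappa t) <= M.
    by rewrite -mulrA; apply/andP; split; exact: ler_wpM2r.
  (* the interval contains a translate of kappa t by an integer *)
  pose l := Num.floor (y - kappa t); rewrite -(cper _ l); apply: hc.
  have := floor_le (y - kappa t); have := floorD1_gt (x - kappa t).
  have : (Num.floor (x - kappa t) + 1)%:~R <= l%:~R :> R.
    rewrite ler_int; move: d0 (floor_diff_ge0 t xy).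
    by rewrite /floor_diff intr_eq0 ler0z -/l; lia.
  by rewrite -/l => h1 h2 h3; apply/andP; split; lra.
have intc : mu.-integrable setT
    (EFin \o (fun t => c (kappa t) * W t * floor_diff x y t)).
  have h : mu.-integrable setT
    (EFin \o (fun t => (`|m| + `|M|) * (W t * floor_diff x y t))).
    exact: (integrableZl measurableT (`|m| + `|M|) (floor_diff_integrable x y)).
  apply: (le_integrable measurableT _ _ h).
    apply/measurable_EFinP; apply: measurable_funM.
      by apply: measurable_funM => //; exact: measurableT_comp.
    rewrite [X in measurable_fun _ X](_ : _ =
        fun t => (Num.floor (y - kappa t))%:~R - (Num.floor (x - kappa t))%:~R).
      exact: measurable_funB (floor_sub_measurable y) (floor_sub_measurable x).
    by apply/funext => t; rewrite /floor_diff rmorphB.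
  move=> t _; rewrite /= lee_fin.
  have W0 : 0 <= W t * floor_diff x y t by rewrite mulr_ge0// floor_diff_ge0.
  have R0 : 0 <= (`|m| + `|M|) * (W t * floor_diff x y t).
    by apply: mulr_ge0 => //; exact: addr_ge0.
  rewrite (ger0_norm R0) ler_norml.
  have /andP[h1 h2] := between t.
  apply/andP; split; [apply: le_trans h1|apply: le_trans h2 _].
    rewrite -mulNr ler_wpM2r//; have := ler_norm (- m).
    by rewrite normrN; have := normr_ge0 M; lra.
  by rewrite ler_wpM2r//; have := ler_norm M; have := normr_ge0 m; lra.
have -> : orbit_cdf (y + b) - orbit_cdf (x + b) =
    \int[mu]_t (c (kappa t) * W t * floor_diff x y t).
  rewrite orbit_cdfB -(@Rintegral_shift _ _ s%:~R).
  - by apply: eq_Rintegral => t _; exact: E.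
  - exact: floor_diff_integrable.
  - by apply: eq_integrable intc => // t _; rewrite /= -E.
rewrite orbit_cdfB -!RintegralZl//; try exact: floor_diff_integrable.
apply/andP; split; apply: le_Rintegral => //.
- exact: (integrableZl measurableT m (floor_diff_integrable x y)).
- by move=> t _; have /andP[] := between t.
- exact: (integrableZl measurableT M (floor_diff_integrable x y)).
- by move=> t _; have /andP[] := between t.
Qed.

End OrbitCdf.

(** * Density of the orbits and strict monotonicity *)

Section IrrationalOrbits.
Variables (R : realType) (alpha : R).
Hypothesis alpha_irr : irrational alpha.

(** Dirichlet: among N + 1 multiples of alpha two have fractional parts in the
    same interval of length 1 / N. *)
Lemma dirichlet_approximation (N : nat) : (0 < N)%N ->
  exists n : nat, exists l : int, (0 < n)%N /\ `|n%:R * alpha - l%:~R| < N%:R^-1.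
Proof.
move=> N0; have N0' : (0 : R) < N%:R by rewrite ltr0n.
pose fr (i : nat) : R := i%:R * alpha - (Num.floor (i%:R * alpha))%:~R.
have fr0 i : 0 <= fr i by rewrite subr_ge0 floor_le.
have fr1 i : fr i < 1.
  by rewrite /fr; have := floorD1_gt (i%:R * alpha); rewrite rmorphD/=; lra.
pose box i := Num.truncn (N%:R * fr i).
have boxP i : (box i)%:R <= N%:R * fr i < (box i).+1%:R.
  by apply: truncn_itv; rewrite mulr_ge0// ltW.
have boxN i : (box i < N)%N.
  rewrite -(ltr_nat R); have /andP[h _] := boxP i; apply: le_lt_trans h _.
  by rewrite -[ltRHS]mulr1 ltr_pM2l.
pose f (i : 'I_N.+1) : 'I_N := Ordinal (boxN i).
have : ~~ injectiveb f.
  by apply/negP => /injectiveP/leq_card; rewrite !card_ord ltnn.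
case/injectivePn => i [j ij [fij]].
wlog lt_ij : i j ij fij / (i < j)%N.
  move=> h; have [||/val_inj E] := ltngtP i j; last by rewrite E eqxx in ij.
    exact: h.
  by apply: h; rewrite // eq_sym.
exists (j - i)%N, (Num.floor (j%:R * alpha) - Num.floor (i%:R * alpha)).
split; first by rewrite subn_gt0.
rewrite natrB ?(ltnW lt_ij)// rmorphB/=.
rewrite (_ : _ - _ = fr j - fr i); last by rewrite /fr; ring.
have /andP[] := boxP i; have /andP[] := boxP j; rewrite fij -natr1 => h1 h2 h3 h4.
rewrite -[ltRHS]mul1r ltr_pdivlMr// -(gtr0_norm N0') -normrM.
by rewrite ltr_norml; lra.
Qed.

Lemma irrational_orbit_dense (x y : R) : x < y ->
  exists n : nat, exists l : int, x < n%:R * alpha + l%:~R < y.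
Proof.
move=> xy; have d0 : 0 < y - x by rewrite subr_gt0.
pose N := Num.bound (y - x)^-1.
have hN : (y - x)^-1 < N%:R by apply: archi_boundP; rewrite invr_ge0 ltW.
have N0 : (0 < N)%N by rewrite -(ltr_nat R) (lt_trans _ hN)// invr_gt0.
have [n [k [n0 hn]]] := dirichlet_approximation N0.
have {}hn : `|n%:R * alpha - k%:~R| < y - x.
  by rewrite (lt_trans hn)// invf_plt// posrE// ltr0n.
have b0 : n%:R * alpha - k%:~R != 0.
  rewrite subr_eq0; have := @irrational_mulz R alpha alpha_irr n k.
  by apply; rewrite eqz_nat -lt0n.
set b := n%:R * alpha - k%:~R in hn b0.
have mulE (m : nat) (l : int) :
    (m * n)%:R * alpha + (l - Posz m * k)%:~R = m%:R * b + l%:~R.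
  by rewrite natrM (rmorphB _ l) rmorphM /b/=; ring.
have [b_gt0|b_lt0|b_eq0] := ltgtP 0 b; last by rewrite -b_eq0 eqxx in b0.
(* Walk by steps b shorter than the interval, starting from an integer on the
   side from which the walk enters it. *)
- pose l := Num.floor x; pose m := (Num.truncn ((x - l%:~R) / b)).+1.
  exists (m * n)%N, (l - Posz m * k); rewrite mulE.
  have h0 : 0 <= (x - l%:~R) / b 
    by apply: divr_ge0; [rewrite subr_ge0 floor_le|exact: ltW].
  have /andP[h1 h2] := truncn_itv h0; rewrite -/m in h2.
  move: h1 h2; rewrite ler_pdivlMr// ltr_pdivrMr// => h1 h2.
  move: hn; rewrite gtr0_norm// => hn.
  have : m%:R * b = (Num.truncn ((x - l%:~R) / b))%:R * b + b.
    by rewrite /m -natr1 mulrDl mul1r.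
  by lra.
- pose l := Num.floor y + 1; pose m := (Num.truncn ((l%:~R - y) / - b)).+1.
  exists (m * n)%N, (l - Posz m * k); rewrite mulE.
  have nb0 : 0 < - b by rewrite oppr_gt0.
  have h0 : 0 <= (l%:~R - y) / - b.
    by apply: divr_ge0; apply: ltW; rewrite ?subr_gt0 ?floorD1_gt.
  have /andP[h1 h2] := truncn_itv h0; rewrite -/m in h2.
  move: h1 h2; rewrite ler_pdivlMr// ltr_pdivrMr// => h1 h2.
  move: hn; rewrite ltr0_norm// => hn.
  have : m%:R * b = (Num.truncn ((l%:~R - y) / - b))%:R * b + b.
    by rewrite /m -natr1 mulrDl mul1r.
  by lra.
Qed.

Variables (kappa W phi : R -> R).
Hypothesis hk : orbit_parametrization alpha kappa.
Hypothesis hW : orbit_density kappa W phi.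

(** By density some translate n * alpha + l of the Cantor set starts in
    the interval, and near its origin the set has positive mass. *)
Lemma orbit_cdf_lt : {homo orbit_cdf kappa W : x y / x < y}.
Proof.
move=> x y xy; have [_ W0 _ _ _] := hW; have [_ _ _ _ small] := hk.
have [n [l /andP[xn ny]]] := irrational_orbit_dense xy.
have e0 : 0 < y - (n%:R * alpha + l%:~R) by rewrite subr_gt0.
have [r r0 hr] := small _ e0.
rewrite -subr_gt0 (orbit_cdfB hk hW).
have hfl t : 0 <= (Num.floor (y - kappa t) - Num.floor (x - kappa t))%:~R :> R.
  by rewrite ler0z subr_ge0 le_floor// lerB// ltW.
apply: (@Rintegral_gt0 _ _ n%:R (n%:R + r)).
- by rewrite ltrDl.
- have := integrableB measurableT (orbit_count_integrable hk hW y)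
    (orbit_count_integrable hk hW x).
  apply: eq_integrable => // t _ /=.
  by rewrite -EFinB -mulrBr -rmorphB/= orbit_countB.
- by move=> t; rewrite mulr_ge0// ltW.
- move=> t /andP[t1 t2]; rewrite mulr_gt0// ltr0z subr_gt0.
  have /hr/andP[k1 k2] : 0 <= t - n%:R < r by rewrite subr_ge0 ltrBlDl t2 ltW.
  have kt : kappa t = kappa (t - n%:R) + n%:R * alpha.
    by rewrite -(kappaDz hk _ n) subrK.
  rewrite -(ltr_int R).
  have h1 : (Num.floor (x - kappa t))%:~R <= x - kappa t by exact: floor_le.
  have h2 : l <= Num.floor (y - kappa t) by rewrite floor_ge_int kt; lra.
  apply: lt_le_trans (_ : l%:~R <= _); last by rewrite ler_int.
  by move: h1; rewrite kt; lra.
Qed.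

End IrrationalOrbits.

(** * Translations in the new coordinate *)

Section Conjugacy.
Variables (R : realType) (H : R -> R).
Hypotheses (H_cont : continuous H) (H_lt : {homo H : x y / x < y}).
Hypothesis H_D1 : forall x, H (x + 1) = H x + 1.

Lemma exists_inverse : exists G : R -> R,
  [/\ cancel H G, cancel G H, continuous G & {homo G : x y / x < y}].
Proof.
have H_le x y : x <= y -> H x <= H y.
  by rewrite le_eqVlt => /orP[/eqP->//|/H_lt/ltW].
have H_inj : injective H.
  by move=> x y E; have [/H_lt|/H_lt|//] := ltgtP x y; rewrite E ltxx.
have surj y : exists x, H x = y.
  pose n := Num.floor (y - H 0).
  have /andP[n1 n2] := floor_itv (y - H 0).
  have hn m : H m%:~R = H 0 + m%:~R by rewrite -[X in H X]add0r (shift_int H_D1) mulr1.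
  have [|||x _ <-] := @IVT R H n%:~R (n + 1)%:~R y; last by exists x.
  - by rewrite ler_int; lia.
  - exact: continuous_subspaceT.
  - rewrite !hn; apply/andP; split.
      by rewrite ge_min -/n; apply/orP; left; move: n1; rewrite -/n; lra.
    by rewrite le_max; apply/orP; right; move: n2; rewrite -/n; lra.
have [G HG] := choice surj.
have GH : cancel H G by move=> x; apply: H_inj; rewrite HG.
have G_lt : {homo G : x y / x < y}.
  by move=> x y xy; rewrite ltNge; apply/negP => /H_le; rewrite !HG leNgt xy.
exists G; split => // x; apply/cvgrPdist_lt => e e0.
have h1 : H (G x - e) < x by rewrite -[ltRHS]HG; apply: H_lt; lra.
have h2 : x < H (G x + e) by rewrite -[ltLHS]HG; apply: H_lt; lra.
near=> y.
have y1 : H (G x - e) < y by near: y; exact: lt_nbhsr.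
have y2 : y < H (G x + e) by near: y; exact: lt_nbhsl.
by move: (G_lt _ _ y1) (G_lt _ _ y2); rewrite !GH ltr_norml; lra.
Unshelve. all: by end_near. Qed.

Variable G : R -> R.
Hypotheses (GK : cancel H G) (HK : cancel G H).
Hypotheses (G_cont : continuous G) (G_lt : {homo G : x y / x < y}).

Definition conj_translation (b x : R) : R := H (G x + b).

Lemma inverseD1 x : G (x + 1) = G x + 1.
Proof. by rewrite -{1}(HK x) -H_D1 GK. Qed.

Lemma conj_translationD1 b x : conj_translation b (x + 1) = conj_translation b x + 1.
Proof. by rewrite /conj_translation inverseD1 addrAC H_D1. Qed.

Lemma conj_translation_comp a b x :
  conj_translation a (conj_translation b x) = conj_translation (b + a) x.
Proof. by rewrite /conj_translation GK addrA. Qed.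

Lemma conj_translation0 x : conj_translation 0 x = x.
Proof. by rewrite /conj_translation addr0 HK. Qed.

Lemma iter_conj_translation n b x :
  iter n (conj_translation b) x = conj_translation (n%:R * b) x.
Proof.
elim: n => [|n IH]; first by rewrite mul0r conj_translation0.
by rewrite iterS IH conj_translation_comp -natr1 mulrDl mul1r.
Qed.

Lemma conj_translation_continuous b : continuous (conj_translation b).
Proof.
move=> x; apply: (@continuous_comp _ _ _ (fun y => G y + b) H); last exact: H_cont.
by apply: cvgD; [exact: G_cont|exact: cvg_cst].
Qed.

Lemma conj_translation_lt b : {homo conj_translation b : x y / x < y}.
Proof. by move=> x y xy; apply: H_lt; rewrite ltrD2r G_lt. Qed.

(** If the translation by b multiplies the H-length of small intervals at z by
    about c z, then c is the derivative of the conjugate in the coordinate H. *)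
Lemma conj_translation_derive (b : R) (c : R -> R) : continuous c ->
  (forall x y m M, x <= y -> (forall z, x <= z <= y -> m <= c z <= M) ->
    m * (H y - H x) <= H (y + b) - H (x + b) <= M * (H y - H x)) ->
  forall x : R, is_derive x (1 : R) (conj_translation b) (c (G x)).
Proof.
move=> c_cont hc x.
suff h : h^-1 *: (conj_translation b (h *: 1 + x) - conj_translation b x)
    @[h --> 0^'] --> c (G x).
  split; first by apply/cvg_ex; exists (c (G x)).
  exact: (cvg_lim (@Rhausdorff R) h).
apply/cvgrPdist_le => e e0.
have /cvgrPdist_le/(_ _ e0)/nbhs_ballP[d /= d0 hd] := c_cont (G x).
near=> h.
have h0 : h != 0 by near: h; exact: nbhs_dnbhs_neq.
have hG : `|G x - G (h + x)| < d.
  near: h; apply: nbhs_dnbhs.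
  have : G (h + x) @[h --> (0 : R)] --> G (0 + x).
    apply: (@continuous_comp _ _ _ (fun h => h + x) G); last exact: G_cont.
    by apply: cvgD; [exact: cvg_id|exact: cvg_cst].
  by rewrite add0r => /cvgrPdist_lt/(_ _ d0).
have cz z : `|G x - z| < d -> c (G x) - e <= c z <= c (G x) + e.
  by move=> /hd /=; rewrite ler_norml => /andP[h1 h2]; apply/andP; split; lra.
rewrite /GRing.scale/= mulr1 /conj_translation.
move: hG; rewrite ltr_norml => /andP[g1 g2].
have [h_lt0|h_gt0|] := ltgtP h 0; last by move/eqP; rewrite (negbTE h0).
- have lt_hx : G (h + x) < G x by apply: G_lt; lra.
  have /andP[k1 k2] := hc _ _ (c (G x) - e) (c (G x) + e) (ltW lt_hx)
    (fun z hz => cz z (ltac:(rewrite ltr_norml; case/andP: hz => *; lra))).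
  rewrite !HK in k1 k2.
  rewrite ler_norml mulrC; apply/andP; split.
    rewrite lerBrDr -lerBrDl opprK ler_ndivrMr//; lra.
  rewrite lerBlDl -lerBlDr ler_ndivlMr//; lra.
- have lt_hx : G x < G (h + x) by apply: G_lt; lra.
  have /andP[k1 k2] := hc _ _ (c (G x) - e) (c (G x) + e) (ltW lt_hx)
    (fun z hz => cz z (ltac:(rewrite ltr_norml; case/andP: hz => *; lra))).
  rewrite !HK in k1 k2.
  rewrite ler_norml mulrC; apply/andP; split.
    rewrite lerBrDr -lerBrDl opprK ler_pdivrMr//; lra.
  rewrite lerBlDl -lerBlDr ler_pdivlMr//; lra.
Unshelve. all: by end_near. Qed.

End Conjugacy.

(** * The law of the orbits *)

Section DensityMeasure.
Variables (R : realType) (f : R -> R).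
Hypotheses (mf : measurable_fun setT f) (f0 : forall t, 0 <= f t).
Notation mu := (@lebesgue_measure R).

Definition density_measure (A : set (measurableTypeR R)) : \bar R :=
  (\int[mu]_(t in A) (f t)%:E)%E.

Let density0 : density_measure set0 = 0%E.
Proof. exact: integral_set0. Qed.

Let density_ge0 A : (0 <= density_measure A)%E.
Proof. by apply: integral_ge0 => t _; rewrite lee_fin. Qed.

Let density_sigma_additive : semi_sigma_additive density_measure.
Proof.
apply: (@semi_sigma_additive_nng_induced _ (measurableTypeR R) R mu
  (fun t => (f t)%:E)) => [|t]; first exact/measurable_EFinP.
by rewrite lee_fin.
Qed.

HB.instance Definition _ := isMeasure.Build _ _ _ density_measure
  density0 density_ge0 density_sigma_additive.

Lemma exists_density_measure : exists nu : {measure set (measurableTypeR R) -> \bar R},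
  forall A, nu A = (\int[mu]_(t in A) (f t)%:E)%E.
Proof. by exists density_measure. Qed.

End DensityMeasure.

Section OrbitLaw.
Variables (R : realType) (alpha : R) (kappa W phi G : R -> R).
Hypothesis alpha_irr : irrational alpha.
Hypothesis hk : orbit_parametrization alpha kappa.
Hypothesis hW : orbit_density kappa W phi.
Notation mu := (@lebesgue_measure R).
Notation H := (orbit_cdf kappa W).
Hypothesis HK : cancel G H.

(** The probability integral transform: a continuous distribution function
    carries its own law to the Lebesgue measure of the unit interval. *)
Lemma orbit_cdf_law (B : set (measurableTypeR R)) : measurable B ->
  mu (B `&` `[0, 1[%classic) =
  (\int[mu]_(t in [set t | B (H (kappa t - (Num.floor (kappa t))%:~R))]) (W t)%:E)%E.
Proof.
have [intW W0 W1 _ _] := hW; have [mk _ _ _ _] := hk.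
have H_lt := orbit_cdf_lt alpha_irr hk hW.
have H0 := orbit_cdf0 hk hW.
have H1 : H 1 = 1 by rewrite -[1 in LHS]add0r (orbit_cdfD1 hk hW) H0 add0r.
have H_le x y : (H x <= H y) = (x <= y).
  have [/H_lt h|/H_lt h|->] := ltgtP x y; last exact: lexx.
    by rewrite ltW.
  by rewrite leNgt h.
pose fr t := kappa t - (Num.floor (kappa t))%:~R.
have fr0 t : 0 <= fr t by rewrite subr_ge0 floor_le.
have fr1 t : fr t < 1.
  by rewrite /fr; have := floorD1_gt (kappa t); rewrite rmorphD/=; lra.
pose theta t := H (fr t).
have theta0 t : 0 <= theta t by rewrite -H0 H_le.
have theta1 t : theta t < 1 by rewrite -H1; apply: H_lt.
have mtheta : measurable_fun setT theta.
  have mH : measurable_fun setT H.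
    by apply: nondecreasing_measurable => // x y; rewrite H_le.
  apply: (measurableT_comp mH); apply: measurable_funB => //.
  exact: (measurableT_comp measurable_floorR).
have mW : measurable_fun setT W by apply/measurable_EFinP; exact: measurable_int intW.
have [nu nuE] := exists_density_measure mW (fun t => ltW (W0 t)).
pose m1 : {measure set (measurableTypeR R) -> \bar R} :=
  mrestr mu (measurable_itv `[(0 : R), 1[).
pose m2 : {measure set (measurableTypeR R) -> \bar R} :=
  measure_function_pushforward__canonical__measure_function_Measure nu
    (mtheta : measurable_fun [set: measurableTypeR R] (theta : _ -> measurableTypeR R)).
move=> mB; rewrite -nuE -[LHS]/(m1 B) -[RHS]/(m2 B).
apply: (@measure_unique _ R (measurableTypeR R) (@RGenOInfty.G R)
  (fun n => `](- n%:R), +oo[%classic) _ _ _ _ m1 m2 _ _ B mB) => //.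
- exact: RGenOInfty.measurableE.
- move=> _ _ [x ->] [y ->]; exists (Num.max x y).
  apply/seteqP; split => z /=; rewrite !in_itv/= !andbT gt_max.
    by case=> -> ->.
  by move/andP.
- by move=> n; exists (- n%:R).
- apply/seteqP; split => // x _; exists (Num.bound `|x|) => //=.
  rewrite in_itv/= andbT ltrNl (le_lt_trans (ler_norm _))// normrN.
  exact: archi_boundP.
- move=> _ [x ->].
  rewrite -[RHS]/(nu (theta @^-1` `]x, +oo[%classic)) nuE.
  rewrite -[LHS]/(mu (`]x, +oo[%classic `&` `[0, 1[%classic)).
  have [x0|x0] := ltP x 0.
    rewrite (_ : `]x, +oo[ `&` `[0, 1[ = `[0, 1[%classic); last first.
      apply/seteqP; split => z /=; rewrite !in_itv/= ?andbT; first by case.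
      by move=> /andP[z0 z1]; rewrite z0 z1 (lt_le_trans x0).
    rewrite (_ : theta @^-1` _ = setT); last first.
      by apply/seteqP; split => // t _ /=; rewrite in_itv/= andbT (lt_le_trans x0).
    rewrite lebesgue_measure_itv/= lte_fin ltr01 oppr0 adde0.
    rewrite -[RHS]fineK; last exact: integrable_fin_num intW.
    by congr (_%:E); exact: esym W1.
  have [x1|x1] := leP 1 x.
    rewrite (_ : `]x, +oo[ `&` `[0, 1[ = set0); last first.
      apply/seteqP; split => z //=; rewrite !in_itv/= ?andbT => -[xz /andP[z0 z1]].
      by move: (lt_trans xz z1); rewrite ltNge x1.
    rewrite (_ : theta @^-1` _ = set0) ?integral_set0 ?measure0//.
    apply/seteqP; split => t //=; rewrite in_itv/= andbT => xt.
    by move: (lt_trans xt (theta1 t)); rewrite ltNge x1.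
  rewrite (_ : `]x, +oo[ `&` `[0, 1[ = `]x, 1[%classic); last first.
    apply/seteqP; split => z /=; rewrite !in_itv/= ?andbT.
      by case=> -> /andP[_ ->].
    by move=> /andP[xz ->]; rewrite (le_trans x0 (ltW xz)) xz.
  rewrite lebesgue_measure_itv/= lte_fin x1 -EFinB.
  set A := theta @^-1` _.
  have mA : measurable (A : set (measurableTypeR R)).
    by rewrite -[A]setTI; exact: (mtheta measurableT _ (measurable_itv _)).
  have intA : mu.-integrable A (EFin \o W).
    exact: integrableS measurableT mA _ intW.
  rewrite -[RHS]fineK; last exact: integrable_fin_num intA.
  congr (_%:E); rewrite -[fine _]/(\int[mu]_(t in A) W t).
  have intT : mu.-integrable (A `|` ~` A) (EFin \o W) by rewrite setUv.
  have := Rintegral_setU mA (measurableC mA) intT.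
  rewrite setUv W1 => ->; last exact/disj_setPCl.
  suff -> : \int[mu]_(t in ~` A) W t = x by rewrite addrK.
  have Gx : 0 <= G x < 1.
    apply/andP; split; first by rewrite -H_le HK H0.
    by rewrite ltNge -H_le HK H1 -ltNge.
  rewrite -[RHS](HK x) orbit_cdf_unit// Rintegral_mkcond.
  apply: eq_Rintegral => t _; rewrite /patch -H_le HK -/(fr t) -/(theta t).
  have -> : (t \in ~` A) = (theta t <= x).
    by apply/idP/idP; rewrite inE /A/= in_itv/= andbT leNgt => /negP.
  by case: ifP => _; rewrite ?mulr1 ?mulr0.
- move=> k; rewrite /m1 /mrestr; apply: le_lt_trans (_ : mu `[0%R, 1%R[%classic < _)%E.
    by apply: le_measure; rewrite ?inE//; apply: measurableI; exact: measurable_itv.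
  by rewrite lebesgue_measure_itv/= lte_fin ltr01 -EFinB ltry.
Qed.

End OrbitLaw.

(** * The diffeomorphism of the circle *)

Section CircleMaps.
Variable R : realType.

Definition circle_map (F : R -> R) (p : circle R) : circle R :=
  circle_proj (F (repr p)).

Lemma circle_map_proj (F : R -> R) : (forall x, F (x + 1) = F x + 1) ->
  forall x, circle_map F (circle_proj x) = circle_proj (F x).
Proof.
move=> FD x; apply/circle_projP.
have /circle_projP/intrP[n hn] : circle_proj (repr (circle_proj x)) = circle_proj x.
  exact: reprK.
have -> : repr (circle_proj x) = x + n%:~R by rewrite -hn addrC subrK.
by rewrite (shift_int FD) mulr1 addrAC subrr add0r intr_int.
Qed.

(** A closed subset of the line that is invariant under integer translations has
    a closed, hence measurable, image in the circle. *)
Lemma measurable_circle_image (A : set R) : closed A ->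
  (forall x (l : int), A x -> A (x + l%:~R)) -> measurable (@circle_proj R @` A).
Proof.
move=> cA Aper; rewrite -[X in measurable X]setCK; apply: measurableC.
apply: sub_sigma_algebra; rewrite /circle_open.
suff : open (@circle_proj R @^-1` (~` (@circle_proj R @` A))) by [].
rewrite (_ : _ @^-1` _ = ~` A); first exact: closed_openC.
apply/seteqP; split => x /=; apply: contra_not; first by exists x.
move=> [y Ay /circle_projP/intrP[n hn]].
have -> : x = y + (- n)%:~R by rewrite rmorphN/= -hn opprB addrC subrK.
exact: Aper.
Qed.

End CircleMaps.

Section Construction.
Variables (R : realType) (alpha : R) (kappa W phi G : R -> R).
Hypothesis alpha_irr : irrational alpha.
Hypothesis hk : orbit_parametrization alpha kappa.
Hypothesis hW : orbit_density kappa W phi.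
Notation mu := (@lebesgue_measure R).
Notation H := (orbit_cdf kappa W).
Hypotheses (GK : cancel H G) (HK : cancel G H).
Hypotheses (G_cont : continuous G) (G_lt : {homo G : x y / x < y}).

Let H_cont : continuous H. Proof. exact: orbit_cdf_continuous hk hW. Qed.
Let H_lt : {homo H : x y / x < y}. Proof. exact: (orbit_cdf_lt alpha_irr hk hW). Qed.
Let H_D1 x : H (x + 1) = H x + 1. Proof. exact: orbit_cdfD1 hk hW x. Qed.

Let T := conj_translation H G.

Let TD1 b x : T b (x + 1) = T b x + 1.
Proof. exact: (conj_translationD1 H_D1 GK HK). Qed.

Let T_H b x : T b (H x) = H (x + b).
Proof. by rewrite /T /conj_translation GK. Qed.

Lemma conj_translation_C1 (s : int) (c : R -> R) : continuous c ->
  (forall t, W (t + s%:~R) = c (kappa t) * W t) ->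
  (forall z, 0 < c z) -> (forall z, c (z + 1) = c z) ->
  real_C1 (T (s%:~R * alpha)).
Proof.
move=> c_cont Wc c0 cD1.
have cper z (l : int) : c (z + l%:~R) = c z.
  have cD0 y : c (y + 1) = c y + 0 by rewrite addr0.
  by rewrite (shift_int cD0) mulr0 addr0.
have mc : measurable_fun setT c by exact: continuous_measurable_fun.
have D : forall x : R, is_derive x (1 : R) (T (s%:~R * alpha)) (c (G x)).
  apply: (conj_translation_derive HK G_cont G_lt c_cont) => x y m M xy hc.
  exact: (orbit_cdf_conformal hk hW Wc mc c0 cper xy hc).
split => [x|]; first by have [] := D x.
rewrite (_ : derive1 _ = c \o G); last first.
  by apply/funext => x; rewrite derive1E; have [_ ->] := D x.
by move=> x; apply: continuous_comp; [exact: G_cont|exact: c_cont].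
Qed.

Let f := circle_map (T alpha).
Let g := circle_map (T (- alpha)).

Let fE x : f (circle_proj x) = circle_proj (T alpha x).
Proof. by apply: circle_map_proj; exact: TD1. Qed.

Let gE x : g (circle_proj x) = circle_proj (T (- alpha) x).
Proof. by apply: circle_map_proj; exact: TD1. Qed.

Let fK : cancel f g.
Proof.
move=> p; have [x <-] := circle_proj_surj p.
by rewrite fE gE /T conj_translation_comp// subrr conj_translation0.
Qed.

Let gK : cancel g f.
Proof.
move=> p; have [x <-] := circle_proj_surj p.
by rewrite gE fE /T conj_translation_comp// addNr conj_translation0.
Qed.

Lemma circle_map_C1_diffeo : circle_C1_diffeo f.
Proof.
have [_ _ _ WD [phiC phi0]] := hW.
exists g; split => //.
- exists (T alpha) => [x|]; first by rewrite fE.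
  have := @conj_translation_C1 1 phi phiC; rewrite mul1r; apply => // z.
    by have [] := phi0 z.
  by have [] := phi0 z.
- exists (T (- alpha)) => [x|]; first by rewrite gE.
  have := @conj_translation_C1 (-1) (fun z => (phi (z - alpha))^-1).
  rewrite mulN1r; apply => [x|t|z|z].
  + apply: cvgV; first by rewrite gt_eqF//; have [] := phi0 (x - alpha).
    apply: (@continuous_comp _ _ _ (fun y => y - alpha) phi); last exact: phiC.
    by apply: cvgB; [exact: cvg_id|exact: cvg_cst].
  + have -> : kappa t - alpha = kappa (t + (-1)%:~R).
      by rewrite (kappaDz hk) rmorphN/= mulN1r.
    rewrite -{3}[t](subrK 1) WD rmorphN/= mulKf// gt_eqF//.
    by have [] := phi0 (kappa (t - 1)).
  + by rewrite invr_gt0; have [] := phi0 (z - alpha).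
  + by rewrite addrAC; have [_ ->] := phi0 (z - alpha).
Qed.

Let iter_f n x : iter n f (circle_proj x) = circle_proj (T (n%:R * alpha) x).
Proof.
elim: n => [|n IH]; first by rewrite mul0r /T conj_translation0.
by rewrite iterS IH fE /T conj_translation_comp// -natr1 mulrDl mul1r.
Qed.

(** In the coordinate H the map is the translation by alpha, whose orbits are
    dense modulo 1. *)
Lemma circle_map_minimal : minimal f.
Proof.
move=> p O [q Oq] oO; have [x <-] := circle_proj_surj p.
have [y yq] := circle_proj_surj q; rewrite -yq in Oq.
have oO' : open (@circle_proj R @^-1` O).
  by move/continuousP: (@circle_proj_continuous R); apply.
have /nbhs_ballP[e /= e0 he] := open_nbhs_nbhs (conj oO' Oq : open_nbhs y _).
have [n [l /andP[h1 h2]]] : exists n : nat, exists l : int,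
    G y - G x < n%:R * alpha + l%:~R < G (y + e) - G x.
  by apply: (irrational_orbit_dense alpha_irr); rewrite ltrD2r G_lt// ltrDl.
exists (circle_proj (T (n%:R * alpha) x)); split; last first.
  by exists (Posz n) => //=; exists (circle_proj x) => //; rewrite iter_f.
have -> : circle_proj (T (n%:R * alpha) x) =
    circle_proj (H (G x + (n%:R * alpha + l%:~R))).
  apply/circle_projP; rewrite addrA (shift_int H_D1) mulr1 opprD addrA.
  by rewrite -/(conj_translation _ _ _ _) subrr sub0r rpredN intr_int.
apply: he; rewrite /ball/= ltr_norml.
have := H_lt (_ : G y < G x + (n%:R * alpha + l%:~R)).
have := H_lt (_ : G x + (n%:R * alpha + l%:~R) < G (y + e)).
rewrite !HK => /(_ ltac:(lra)) k1 /(_ ltac:(lra)) k2.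
by apply/andP; split; lra.
Qed.

(** H stays within distance 1 of the identity, so the conjugacy does not
    change the translation number. *)
Lemma circle_map_rotation_number : has_rotation_number f (circle_proj alpha).
Proof.
exists (T alpha), alpha; split => //.
  split; [by move=> x; rewrite fE| | |exact: TD1].
  - exact: conj_translation_continuous.
  - exact: conj_translation_lt.
move=> x.
have H_near z : `|H z - z| <= 1.
  have H0 := orbit_cdf0 hk hW; have H_nd := orbit_cdf_nd hk hW.
  have Hn (m : int) : H m%:~R = m%:~R.
    by rewrite -[X in H X]add0r (shift_int H_D1) H0 add0r mulr1.
  have := H_nd _ _ (floor_le z); have := H_nd _ _ (ltW (floorD1_gt z)).
  have := floor_le z; have := floorD1_gt z; rewrite !Hn rmorphD/= ler_norml.
  by move=> *; apply/andP; split; lra.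
pose K := 1 + `|G x - x|.
have hK n : `|iter n (T alpha) x - x - n%:R * alpha| <= K.
  rewrite /T iter_conj_translation// /conj_translation.
  set z := G x + _.
  rewrite (_ : _ - _ - _ = (H z - z) + (G x - x)); last by rewrite /z; ring.
  by rewrite (le_trans (ler_normD _ _))// lerD2r.
apply/cvgrPdist_le => e e0; near=> n.
have n0 : (0 : R) < n%:R.
  by rewrite ltr0n; near: n; exact: nbhs_infty_gt.
have nK : K / e <= n%:R by near: n; exact: nbhs_infty_ger.
rewrite distrC (_ : _ - _ = (iter n (T alpha) x - x - n%:R * alpha) / n%:R); last first.
  by field; rewrite gt_eqF.
rewrite normrM normfV (gtr0_norm n0) ler_pdivrMr// (le_trans (hK n))//.
by rewrite mulrC -ler_pdivrMr.
Unshelve. all: by end_near. Qed.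

(* The Cantor set, lifted to the line; the closure makes it Borel. *)
Let E : set R := closure [set x | exists t (l : int),
  0 <= t < 1 /\ x = kappa t + l%:~R].

Let E_per x (l : int) : E x -> E (x + l%:~R).
Proof.
move=> Ex B /nbhs_ballP[e /= e0 he].
have [y [[t [m [t01 ->]]] hy]] := Ex _ (nbhsx_ballx x e e0).
exists (kappa t + (m + l)%:~R); split; first by exists t, (m + l).
apply: he; move: hy; rewrite /ball/= rmorphD/=.
by rewrite (_ : x + _ - _ = x - (kappa t + m%:~R))//; ring.
Qed.

(* Distinct rotates are at a positive distance from each other, so passing to
   the closure keeps them disjoint. *)
Let E_disjoint x y (n m l : int) : E x -> E y ->
  x + n%:~R * alpha = y + m%:~R * alpha + l%:~R -> n = m.
Proof.
move=> Ex Ey xy; apply/eqP; apply: contraT => nm.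
have [_ _ _ sep _] := hk; have [e e0 he] := sep `|n - m|%N.
have e3 : 0 < e / 3 by rewrite divr_gt0.
have [_ [[s [a [s01 ->]]] hs]] := Ex _ (nbhsx_ballx x _ e3).
have [_ [[t [b [t01 ->]]] ht]] := Ey _ (nbhsx_ballx y _ e3).
have fl r (k : int) : 0 <= r < 1 -> Num.floor (r + k%:~R : R) = k.
  by move=> r01; rewrite floorDrz ?intr_int// intrKfloor (@floor_def _ r 0) ?add0r.
have := he (s + n%:~R) (t + m%:~R) (b - a + l).
rewrite !fl// => /(_ nm (leqnn _)); rewrite !(kappaDz hk) !rmorphD rmorphN/=.
move: hs ht; rewrite /ball/= !ltr_norml leNgt => /andP[s1 s2] /andP[t1 t2].
by rewrite ltr_norml => /negP[]; apply/andP; split; lra.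
Qed.

Let C : set (circle R) := @circle_proj R @` (H @` E).

Let ziter_C (n : int) : ziter_image f n C =
  @circle_proj R @` (H @` [set x | E (x - n%:~R * alpha)]).
Proof.
have HE b x : circle_proj (T b (H x)) = circle_proj (H (x + b)) by rewrite T_H.
case: n => n /=.
  apply/seteqP; split => [_ [_ [_ [x Ex <-] <-] <-]|_ [_ [x Ex <-] <-]].
    rewrite iter_f HE; exists (H (x + n%:R * alpha)) => //.
    by exists (x + n%:R * alpha) => //=; rewrite addrK.
  exists (circle_proj (H (x - n%:R * alpha))).
    by exists (H (x - n%:R * alpha)) => //; exists (x - n%:R * alpha).
  by rewrite iter_f HE; congr (circle_proj (H _)); exact: subrK.
have NE : (Negz n)%:~R = - n.+1%:R :> R by rewrite NegzE rmorphN.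
rewrite NE mulNr opprK.
apply/seteqP; split => [p|_ [_ [x Ex <-] <-]] /=.
  have [y <-] := circle_proj_surj p; rewrite -[y]HK -iterS iter_f HE.
  move=> [_ [x Ex <-]] /circle_projP; rewrite -/H => /intrP[l hl].
  exists (H (G y)) => //; exists (G y) => //=.
  have -> : G y + n.+1%:R * alpha = x + (- l)%:~R.
    rewrite -[LHS]GK -[RHS]GK (shift_int H_D1) mulr1; congr (G _).
    by rewrite rmorphN/= -hl opprB [RHS]addrC subrK.
  exact: E_per.
by rewrite -iterS iter_f HE; exists (H (x + n.+1%:R * alpha)).
Qed.

Let measurable_ziter_C n : measurable (ziter_image f n C).
Proof.
rewrite ziter_C; apply: measurable_circle_image.
  rewrite (_ : _ @` _ = (fun x => G x - n%:~R * alpha) @^-1` E).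
    apply: closed_comp; last exact: closed_closure.
    move=> x _; apply: cvgB; [exact: G_cont|exact: cvg_cst].
  apply/seteqP; split => [_ [x Ex <-]|x Ex] /=; first by rewrite GK.
  by exists (G x).
move=> _ l [x /= Ex <-]; exists (x + l%:~R); last by rewrite (shift_int H_D1) mulr1.
by rewrite /= addrAC; exact: E_per.
Qed.

(** The images of C are the H-images of the rotates of the Cantor set; these are
    disjoint.  Their union is conull since almost every point of the circle is
    of the form H (kappa t) modulo 1. *)
Lemma circle_map_fundamental_domain :
  measurable_fundamental_domain (circle_lebesgue R) f C.
Proof.
split.
- have := measurable_ziter_C 0; rewrite (_ : ziter_image f 0 C = C)//.
  by apply/seteqP; split => [_ [p Cp <-]//|p Cp]; exists p.
- move=> n m _ _ [p []]; rewrite !ziter_C.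
  move=> [_ [x /= Ex <-] <-] [_ [y /= Ey <-]] /circle_projP/intrP[l hl].
  apply: (E_disjoint (x := x - n%:~R * alpha) (y := y - m%:~R * alpha) (l := - l)) => //.
  rewrite !subrK -[LHS]GK -[RHS]GK (shift_int H_D1) mulr1 rmorphN/= -hl.
  by congr (G _); rewrite opprB [RHS]addrC subrK.
- set U := \bigcup_(n in _) _.
  have mU : measurable U by apply: countable_bigcupT_measurable.
  exists (~` U); split => //; first exact: measurableC.
  have mB : measurable (@circle_proj R @^-1` (~` U) : set (measurableTypeR R)).
    by rewrite -[X in measurable X]setTI; apply: measurable_circle_proj => //;
      exact: measurableC.
  apply: etrans (orbit_cdf_law alpha_irr hk hW HK mB) _.
  rewrite (_ : [set t | _] = set0) ?integral_set0//.
  apply/seteqP; split => // t /=; apply.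
  pose n := Num.floor t; exists n => //; rewrite ziter_C.
  exists (H (kappa t - (Num.floor (kappa t))%:~R)) => //.
  exists (kappa t - (Num.floor (kappa t))%:~R) => //=.
  apply: subset_closure; exists (t - n%:~R), (- Num.floor (kappa t)); split.
    by rewrite subr_ge0 floor_le/= ltrBlDr addrC -(rmorphD _ n 1) floorD1_gt.
  by rewrite -{1}[t](subrK n%:~R) (kappaDz hk) rmorphN/=; ring.
Qed.

End Construction.

Theorem theorem1p1 (R : realType) (alpha : R) (h_alpha : irrational alpha) :
  exists f : circle R -> circle R,
    [/\ circle_C1_diffeo f,
        minimal f,
        has_rotation_number f (circle_proj alpha) &
        exists C : set (circle R),
          measurable_fundamental_domain (circle_lebesgue R) f C].
Proof.
have [kappa hk] := exists_orbit_parametrization h_alpha.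
have [W [phi hW]] := exists_orbit_density hk.
have [G [GK HK G_cont G_lt]] := exists_inverse (orbit_cdf_continuous hk hW)
  (orbit_cdf_lt h_alpha hk hW) (orbit_cdfD1 hk hW).
exists (circle_map (conj_translation (orbit_cdf kappa W) G alpha)); split.
- exact: circle_map_C1_diffeo hk hW GK HK G_cont G_lt.
- exact: circle_map_minimal h_alpha hk hW GK HK G_lt.
- exact: circle_map_rotation_number h_alpha hk hW GK HK G_cont G_lt.
- eexists; exact: circle_map_fundamental_domain h_alpha hk hW GK HK G_cont.
Qed.
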